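(* For $u\in\mathrm{Sp}(1)$, $\epsilon_1,\epsilon_2\in\{\pm1\}$, $t\in\mathbb{R}$ and $q\in\mathbb{B}$ define \[ (u,\epsilon_1,H(t),\epsilon_2)\cdot q=\begin{cases}\epsilon_1u(1+\tanh(t)q)^{-1}(q+\tanh(t))\overline{u}, & \epsilon_2=+1,\\ \epsilon_1u(1+\tanh(t)\overline{q})^{-1}(\overline{q}+\tanh(t))\overline{u}, & \epsilon_2=-1.\end{cases} \] These maps define a left action of the group $\mathrm{Sp}(1)\times(\mathbb{Z}_2\ltimes\mathrm{SO}_0(1,1))\times\mathbb{Z}_2$ on $\mathbb{B}$, and the set of transformations given by this action is the full isometry group of $(\mathbb{B},g)$, where $g$ is the slice Riemannian metric.
   Context: $\mathbb{H}$ denotes the quaternions, $\mathbb{B}=\{q\in\mathbb{H}:|q|<1\}$, $\mathrm{Sp}(1)=\{u\in\mathbb{H}:|u|=1\}$, $\mathbb{Z}_2=\{\pm1\}$ under multiplication. For $t\in\mathbb{R}$, $H(t)=\begin{pmatrix}\cosh t&\sinh t\\ \sinh t&\cosh t\end{pmatrix}$ and $\mathrm{SO}_0(1,1)=\{H(t):t\in\mathbb{R}\}$. The group $\mathbb{Z}_2\ltimes\mathrm{SO}_0(1,1)$ is the set $\{\pm1\}\times\mathrm{SO}_0(1,1)$ with product $(\epsilon_1,H(t_1))\star(\epsilon_2,H(t_2))=(\epsilon_1\epsilon_2,H(\epsilon_2t_1+t_2))$; the group $\mathrm{Sp}(1)\times(\mathbb{Z}_2\ltimes\mathrm{SO}_0(1,1))\times\mathbb{Z}_2$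 carries the direct product structure of its three factors. The slice Riemannian metric on $\mathbb{B}$ is, for $q\in\mathbb{B}$ and $\alpha,\beta\in T_q\mathbb{B}=\mathbb{H}$, \[ g_q(\alpha,\beta)=\frac{\operatorname{Re}\big((\alpha-q\alpha q)\overline{(\beta-q\beta q)}\big)}{|1-q^2|^2(1-|q|^2)^2}. \] *)

(* Defs.v *)
(* Quaternions are modelled as 'rV[R]_4
   (coordinates 1, i, j, k), which carries the normed-module structure needed
   for directional derivatives. *)
From HB Require Import structures.
From mathcomp Require Import all_boot all_order all_algebra.
From mathcomp Require Import all_classical all_reals all_analysis.
Set Implicit Arguments. Unset Strict Implicit. Unset Printing Implicit Defensive.
Import Order.TTheory GRing.Theory Num.Theory.
Import numFieldNormedType.Exports.
Local Open Scope ring_scope.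
Local Open Scope classical_set_scope.

Section Quat.
Variable R : realType.

Definition quat := 'rV[R]_4.

Definition mkQ (a b c d : R) : quat := \row_(i < 4) nth 0 [:: a; b; c; d] i.
Definition q0 (q : quat) := q ord0 (inord 0).
Definition q1 (q : quat) := q ord0 (inord 1).
Definition q2 (q : quat) := q ord0 (inord 2).
Definition q3 (q : quat) := q ord0 (inord 3).

Definition qmul (p q : quat) : quat :=
  mkQ (q0 p * q0 q - q1 p * q1 q - q2 p * q2 q - q3 p * q3 q)
      (q0 p * q1 q + q1 p * q0 q + q2 p * q3 q - q3 p * q2 q)
      (q0 p * q2 q - q1 p * q3 q + q2 p * q0 q + q3 p * q1 q)
      (q0 p * q3 q + q1 p * q2 q - q2 p * q1 q + q3 p * q0 q).

Definition qconj (q : quat) : quat := mkQ (q0 q) (- q1 q) (- q2 q) (- q3 q).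
Definition qnorm2 (q : quat) : R := q0 q ^+ 2 + q1 q ^+ 2 + q2 q ^+ 2 + q3 q ^+ 2.
Definition qRe (q : quat) : R := q0 q.
Definition qreal (r : R) : quat := mkQ r 0 0 0.
Definition qinv (q : quat) : quat := (qnorm2 q)^-1 *: qconj q.

Definition qball : set quat := [set q | qnorm2 q < 1].
Definition Sp1 : set quat := [set u | qnorm2 u = 1].

Definition slice_g (q alpha beta : quat) : R :=
  qRe (qmul (alpha - qmul (qmul q alpha) q)
            (qconj (beta - qmul (qmul q beta) q)))
  / (qnorm2 (qreal 1 - qmul q q) * (1 - qnorm2 q) ^+ 2).

Definition tanh (t : R) : R := (expR t - expR (- t)) / (expR t + expR (- t)).

(* elements (u, eps1, H(t), eps2) of Sp(1) x (Z2 |x SO_0(1,1)) x Z2;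
   H(t) is recorded by its (unique) parameter t *)
Definition grp := (quat * R * R * R)%type.

Definition in_grp (x : grp) : Prop :=
  let: (u, e1, t, e2) := x in
  Sp1 u /\ (e1 = 1 \/ e1 = -1) /\ (e2 = 1 \/ e2 = -1).

(* product: direct product of Sp(1), Z2 |x SO_0(1,1) with
   (e1,H(t1)) * (e2,H(t2)) = (e1 e2, H(e2 t1 + t2)), and Z2 *)
Definition grp_mul (x y : grp) : grp :=
  let: (u, e1, t, e2) := x in
  let: (u', e1', t', e2') := y in
  (qmul u u', e1 * e1', e1' * t + t', e2 * e2').

Definition grp_one : grp := (qreal 1, 1, 0, 1).

Definition act (x : grp) (q : quat) : quat :=
  let: (u, e1, t, e2) := x in
  let a := qreal (tanh t) in
  if e2 == 1 then
    e1 *: qmul (qmul u (qmul (qinv (qreal 1 + qmul a q)) (q + a))) (qconj u)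
  else
    e1 *: qmul (qmul u (qmul (qinv (qreal 1 + qmul a (qconj q)))
                             (qconj q + a))) (qconj u).

Fixpoint iter_D (vs : seq quat) (f : quat -> quat) : quat -> quat :=
  match vs with
  | [::] => f
  | v :: vs' => 'D_v (iter_D vs' f)
  end.

Definition smooth_on (A : set quat) (f : quat -> quat) : Prop :=
  forall vs : seq quat,
    (forall x, A x -> {for x, continuous (iter_D vs f)}) /\
    (forall v x, A x -> derivable (iter_D vs f) x v).

Definition slice_isometry (f : quat -> quat) : Prop :=
  [/\ smooth_on qball f,
      (forall q, qball q -> qball (f q)),
      (exists h : quat -> quat,
          [/\ smooth_on qball h,
              (forall q, qball q -> qball (h q)),
              (forall q, qball q -> h (f q) = q) &
              (forall q, qball q -> f (h q) = q)]) &
      (forall q alpha beta, qball q ->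
          slice_g (f q) ('D_alpha f q) ('D_beta f q) = slice_g q alpha beta)].

End Quat.

(* Main.v *)
(* The maps act preserve g because the Moebius map M of parameter a satisfies
   M(p) - M(q) = (1 - a^2) P(q) (p - q) P(p) with P(q) = (1 + a q)^-1.

   For the converse no curvature is needed. The Gauss lemma at 0 shows that an
   isometry fixing 0 preserves |q| and maps rays to rays, so it is the restriction
   of an orthogonal linear map; since g is isotropic on the real diameter only,
   this map preserves the real axis and therefore comes from Sp(1), the sign and
   the conjugation. It remains to see that the orbit of 0 under all isometries
   consists of real points. The group moves f(0) to tanh(d) i with d >= 0.
   If d > 0, the reflection fixing R i shows that f maps a diameter onto R i as a
   translation by d; composing f, -id and f^-1 gives an isometry that translates
   by 2 d. But half circles centred at 0 in R i + R j have length less than 2,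
   which bounds d: a contradiction. *)
Require Import Defs.
From HB Require Import structures.
From mathcomp Require Import all_boot all_order all_algebra.
From mathcomp Require Import all_classical all_reals all_analysis.
From mathcomp Require Import ring lra.
Set Implicit Arguments. Unset Strict Implicit. Unset Printing Implicit Defensive.
Import Order.TTheory GRing.Theory Num.Theory.
Import numFieldNormedType.Exports.
Local Open Scope ring_scope.
Local Open Scope classical_set_scope.

(** The action is not transitive, so something must tell the real points from the others. At an
    imaginary point q the metric blows up near the boundary along q, but not along an imaginary
    direction orthogonal to q: such a vector anticommutes with q, so the numerator of g gains a
    factor (1 - |q|^2)^2 that cancels the one in the denominator. Circles about 0 in R i + R j
    therefore stay short up to the boundary, while their points move arbitrarily far from 0. Seen
    from an origin shifted by d, the two ends of a diameter on R i lie at distances differing by 2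
    d, although a short arc joins them. Iterating the doubling makes the shift exceed any bound.

    Neither lengths of curves nor an infimum distance is defined. The explicit function [hdist]
    grows along a curve no faster than the speed, by the mean value theorem, and this replaces both.
    Since [hdist] is not differentiable at 0, the curves compared must avoid 0.

    [smooth_on] speaks of directional derivatives only; the chain rule needs differentiability,
    which comes from the continuity of the partial derivatives. *)

Section QuatAlgebra.
Variable R : realType.
Implicit Types (p q r u v : quat R) (a b c d k : R).

Lemma q0_mkQ a b c d : q0 (mkQ a b c d) = a.
Proof. by rewrite /q0 mxE inordK. Qed.
Lemma q1_mkQ a b c d : q1 (mkQ a b c d) = b.
Proof. by rewrite /q1 mxE inordK. Qed.
Lemma q2_mkQ a b c d : q2 (mkQ a b c d) = c.
Proof. by rewrite /q2 mxE inordK. Qed.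
Lemma q3_mkQ a b c d : q3 (mkQ a b c d) = d.
Proof. by rewrite /q3 mxE inordK. Qed.

Lemma q0D p q : q0 (p + q) = q0 p + q0 q. Proof. by rewrite /q0 mxE. Qed.
Lemma q1D p q : q1 (p + q) = q1 p + q1 q. Proof. by rewrite /q1 mxE. Qed.
Lemma q2D p q : q2 (p + q) = q2 p + q2 q. Proof. by rewrite /q2 mxE. Qed.
Lemma q3D p q : q3 (p + q) = q3 p + q3 q. Proof. by rewrite /q3 mxE. Qed.
Lemma q0N p : q0 (- p) = - q0 p. Proof. by rewrite /q0 mxE. Qed.
Lemma q1N p : q1 (- p) = - q1 p. Proof. by rewrite /q1 mxE. Qed.
Lemma q2N p : q2 (- p) = - q2 p. Proof. by rewrite /q2 mxE. Qed.
Lemma q3N p : q3 (- p) = - q3 p. Proof. by rewrite /q3 mxE. Qed.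
Lemma q0Z k p : q0 (k *: p) = k * q0 p. Proof. by rewrite /q0 mxE. Qed.
Lemma q1Z k p : q1 (k *: p) = k * q1 p. Proof. by rewrite /q1 mxE. Qed.
Lemma q2Z k p : q2 (k *: p) = k * q2 p. Proof. by rewrite /q2 mxE. Qed.
Lemma q3Z k p : q3 (k *: p) = k * q3 p. Proof. by rewrite /q3 mxE. Qed.
Lemma q0_0 : q0 (0 : quat R) = 0. Proof. by rewrite /q0 mxE. Qed.
Lemma q1_0 : q1 (0 : quat R) = 0. Proof. by rewrite /q1 mxE. Qed.
Lemma q2_0 : q2 (0 : quat R) = 0. Proof. by rewrite /q2 mxE. Qed.
Lemma q3_0 : q3 (0 : quat R) = 0. Proof. by rewrite /q3 mxE. Qed.

Definition qcoordE := (q0_mkQ, q1_mkQ, q2_mkQ, q3_mkQ, (q0D, q1D, q2D, q3D),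
  (q0N, q1N, q2N, q3N), (q0Z, q1Z, q2Z, q3Z), (q0_0, q1_0, q2_0, q3_0)).

Lemma quatP p q : q0 p = q0 q -> q1 p = q1 q -> q2 p = q2 q -> q3 p = q3 q ->
  p = q.
Proof.
rewrite /q0 /q1 /q2 /q3 => h0 h1 h2 h3; apply/rowP => i.
have -> : i = inord i by rewrite inord_val.
by case: i => -[|[|[|[|//]]]] /= _.
Qed.

End QuatAlgebra.

Ltac qexpand := rewrite /qmul /qconj /qreal /qRe ?qcoordE.
Ltac qring := apply: quatP; qexpand; ring.

(** * Quaternion identities and Moebius maps with a real parameter *)

Section QuatIdentities.
Variable R : realType.
Implicit Types (p q r u v : quat R) (a b c d k : R).

Local Notation "p ** q" := (qmul p q) (at level 40, left associativity).

Lemma qmulA p q r : p ** (q ** r) = p ** q ** r. Proof. by qring. Qed.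
Lemma qmulDl p q r : (p + q) ** r = p ** r + q ** r. Proof. by qring. Qed.
Lemma qmulDr p q r : r ** (p + q) = r ** p + r ** q. Proof. by qring. Qed.
Lemma qmulBl p q r : (p - q) ** r = p ** r - q ** r. Proof. by qring. Qed.
Lemma qmulBr p q r : r ** (p - q) = r ** p - r ** q. Proof. by qring. Qed.
Lemma qmulZl k p q : (k *: p) ** q = k *: (p ** q). Proof. by qring. Qed.
Lemma qmulZr k p q : p ** (k *: q) = k *: (p ** q). Proof. by qring. Qed.
Lemma qmul1l p : qreal 1 ** p = p. Proof. by qring. Qed.
Lemma qmul1r p : p ** qreal 1 = p. Proof. by qring. Qed.
Lemma qmulrl k p : qreal k ** p = k *: p. Proof. by qring. Qed.
Lemma qmulrr k p : p ** qreal k = k *: p. Proof. by qring. Qed.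
Lemma qreal0 : qreal 0 = 0 :> quat R. Proof. by qring. Qed.
Lemma qconjM p q : qconj (p ** q) = qconj q ** qconj p. Proof. by qring. Qed.
Lemma qconjD p q : qconj (p + q) = qconj p + qconj q. Proof. by qring. Qed.
Lemma qconjZ k p : qconj (k *: p) = k *: qconj p. Proof. by qring. Qed.
Lemma qconjK p : qconj (qconj p) = p. Proof. by qring. Qed.
Lemma qmulC_conj p : p ** qconj p = qreal (qnorm2 p).
Proof. by rewrite /qnorm2; qring. Qed.
Lemma qmul_conjC p : qconj p ** p = qreal (qnorm2 p).
Proof. by rewrite /qnorm2; qring. Qed.

Lemma qnorm2M p q : qnorm2 (p ** q) = qnorm2 p * qnorm2 q.
Proof. by rewrite /qnorm2; qexpand; ring. Qed.
Lemma qnorm2Z k p : qnorm2 (k *: p) = k ^+ 2 * qnorm2 p.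
Proof. by rewrite /qnorm2; qexpand; ring. Qed.
Lemma qnorm2_conj p : qnorm2 (qconj p) = qnorm2 p.
Proof. by rewrite /qnorm2; qexpand; ring. Qed.
Lemma qnorm2_real k : qnorm2 (qreal k : quat R) = k ^+ 2.
Proof. by rewrite /qnorm2; qexpand; ring. Qed.
Lemma qnorm2_ge0 p : 0 <= qnorm2 p.
Proof. by rewrite /qnorm2 !addr_ge0// sqr_ge0. Qed.
Lemma qnorm2_0 : qnorm2 (0 : quat R) = 0.
Proof. by rewrite /qnorm2; qexpand; ring. Qed.
Lemma qnorm2_eq0 p : qnorm2 p = 0 -> p = 0.
Proof.
move: (sqr_ge0 (q0 p)) (sqr_ge0 (q1 p)) (sqr_ge0 (q2 p)) (sqr_ge0 (q3 p)).
rewrite /qnorm2 => h0 h1 h2 h3 h.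
have e0 : q0 p ^+ 2 = 0 by lra.
have e1 : q1 p ^+ 2 = 0 by lra.
have e2 : q2 p ^+ 2 = 0 by lra.
have e3 : q3 p ^+ 2 = 0 by lra.
by apply: quatP; rewrite ?qcoordE; apply/eqP; rewrite -sqrf_eq0; apply/eqP.
Qed.
Lemma qnorm2_gt0 p : p != 0 -> 0 < qnorm2 p.
Proof.
move=> p0; rewrite lt_neqAle qnorm2_ge0 andbT eq_sym.
by apply: contraNneq p0 => /qnorm2_eq0 ->.
Qed.

Definition qdot p q : R := q0 p * q0 q + q1 p * q1 q + q2 p * q2 q + q3 p * q3 q.

Lemma qdotE p q : qRe (p ** qconj q) = qdot p q.
Proof. by rewrite /qdot; qexpand; ring. Qed.
Lemma qdotpp p : qdot p p = qnorm2 p.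
Proof. by rewrite /qdot /qnorm2; ring. Qed.
Lemma qdotMl r p q : qdot (r ** p) (r ** q) = qnorm2 r * qdot p q.
Proof. by rewrite /qdot /qnorm2; qexpand; ring. Qed.
Lemma qdotMr r p q : qdot (p ** r) (q ** r) = qnorm2 r * qdot p q.
Proof. by rewrite /qdot /qnorm2; qexpand; ring. Qed.
Lemma qdotZ k p q : qdot (k *: p) (k *: q) = k ^+ 2 * qdot p q.
Proof. by rewrite /qdot; qexpand; ring. Qed.

Definition qslice q v : quat R := v - q ** v ** q.
Definition qden q : R := qnorm2 (qreal 1 - q ** q).

Lemma slice_gE q u v : slice_g q u v =
  qdot (qslice q u) (qslice q v) / (qden q * (1 - qnorm2 q) ^+ 2).
Proof. by rewrite /slice_g qdotE. Qed.

Lemma qdenE q : qden q =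
  (1 - qnorm2 q) ^+ 2 + 4 * (q1 q ^+ 2 + q2 q ^+ 2 + q3 q ^+ 2).
Proof. by rewrite /qden /qnorm2; qexpand; ring. Qed.

Lemma qden_gt0 q : qball q -> 0 < qden q.
Proof.
rewrite /qball /= => h; rewrite qdenE ltr_wpDr//.
  by rewrite mulr_ge0// !addr_ge0// sqr_ge0.
by rewrite exprn_gt0// subr_gt0.
Qed.

Lemma qball0 : qball (0 : quat R).
Proof. by rewrite /qball /= qnorm2_0. Qed.

Definition mob a q : quat R := qinv (qreal 1 + a *: q) ** (q + qreal a).

Definition mobN a q : R := 1 + 2 * a * q0 q + a ^+ 2 * qnorm2 q.

Lemma mobNE a q : qnorm2 (qreal 1 + a *: q) = mobN a q.
Proof. by rewrite /mobN /qnorm2; qexpand; ring. Qed.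

(** The numerator is (1 + a conj(q)) (q + a) expanded. In this form everything is built from q,
    conj(q) and real numbers, so that compatibility with conjugation and rotations is visible. *)
Lemma mobE a q : mob a q =
  (mobN a q)^-1 *: (q + qreal (a * (1 + qnorm2 q)) + a ^+ 2 *: qconj q).
Proof.
rewrite /mob /qinv mobNE qmulZl; congr (_ *: _).
by rewrite /qnorm2; qring.
Qed.

Lemma mobN_gt0 a q : a ^+ 2 < 1 -> qball q -> 0 < mobN a q.
Proof.
rewrite /qball /= => ha hq; rewrite -mobNE qnorm2_gt0//.
apply/eqP => /(congr1 (fun z => qnorm2 (z - qreal 1))).
rewrite (_ : _ + _ - _ = a *: q); last by qring.
rewrite qnorm2Z sub0r -scaleN1r qnorm2Z qnorm2_real => h.
have := qnorm2_ge0 q; nra.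
Qed.

(** Comes from |1 + a q|^2 - |q + a|^2 = (1 - a^2) (1 - |q|^2); the norm of the numerator in [mobE]
    is [mobN a q] times |q + a|^2. *)
Lemma mob_norm a q : mobN a q != 0 ->
  1 - qnorm2 (mob a q) = (1 - a ^+ 2) * (1 - qnorm2 q) / mobN a q.
Proof.
move=> N0; rewrite mobE qnorm2Z.
rewrite (_ : qnorm2 (_ + _ + _) =
   mobN a q * (mobN a q - (1 - a ^+ 2) * (1 - qnorm2 q))).
  by field.
by rewrite /mobN /qnorm2; qexpand; ring.
Qed.

Lemma mob_ball a q : a ^+ 2 < 1 -> qball q -> qball (mob a q).
Proof.
move=> ha hq; have N0 := mobN_gt0 ha hq; rewrite /qball /= -subr_gt0.
rewrite mob_norm ?gt_eqF// divr_gt0// mulr_gt0// subr_gt0//.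
Qed.

Lemma mob0 q : mob 0 q = q.
Proof.
rewrite mobE /mobN !mulr0 !mul0r expr0n /= !mul0r !addr0 invr1 scale1r scale0r.
by rewrite qreal0 !addr0.
Qed.

Lemma mobN0 a b q : 1 + a * b != 0 -> mobN b q != 0 ->
  mobN a (mob b q) = (1 + a * b) ^+ 2 * mobN ((a + b) / (1 + a * b)) q / mobN b q.
Proof.
move=> ab N0.
rewrite {1}/mobN; have -> : qnorm2 (mob b q) = 1 - (1 - b ^+ 2) * (1 - qnorm2 q) / mobN b q.
  by rewrite -mob_norm//; ring.
rewrite mobE; qexpand; move: N0; rewrite /mobN /qnorm2 => N0.
by field; rewrite ab N0.
Qed.

(** The matrices with rows (1, a), (a, 1) and (1, b), (b, 1) multiply to 1 + a b times the matrix of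
    the parameter (a + b) / (1 + a b). This is the addition law of tanh. *)
Lemma mob_mob a b q : 1 + a * b != 0 -> mobN b q != 0 ->
  mobN ((a + b) / (1 + a * b)) q != 0 ->
  mob a (mob b q) = mob ((a + b) / (1 + a * b)) q.
Proof.
move=> ab Nb Nc.
rewrite [LHS]mobE mobN0//.
have -> : qnorm2 (mob b q) = 1 - (1 - b ^+ 2) * (1 - qnorm2 q) / mobN b q.
  by rewrite -mob_norm//; ring.
rewrite !mobE.
set N := mobN b q in Nb *; set M := mobN _ q in Nc *.
have eN : N = 1 + 2 * b * q0 q + b ^+ 2 * qnorm2 q by [].
apply: quatP; qexpand; rewrite ?eN; field; rewrite -?eN ab Nb Nc//.
Qed.
End QuatIdentities.

(** * The laws of the action *)

Section GroupLaws.
Variable R : realType.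
Implicit Types (p q r u v : quat R) (a b c d k s t e : R).

Local Notation "p ** q" := (qmul p q) (at level 40, left associativity).

Lemma tanh_expR t : tanh t = (expR t ^+ 2 - 1) / (expR t ^+ 2 + 1).
Proof.
rewrite /tanh expRN; have x0 := expR_gt0 t; set x := expR t in x0 *.
have h : x ^+ 2 + 1 != 0 by rewrite gt_eqF// ltr_wpDl// sqr_ge0.
by field; rewrite h gt_eqF.
Qed.

Lemma tanh0 : tanh (0 : R) = 0.
Proof. by rewrite tanh_expR expR0 expr1n subrr mul0r. Qed.

Lemma tanhN t : tanh (- t) = - tanh t.
Proof. by rewrite /tanh opprK -mulNr opprB addrC [_ + expR t]addrC. Qed.

Lemma tanh_sqr_lt1 t : tanh t ^+ 2 < 1.
Proof.
rewrite tanh_expR; have x0 := expR_gt0 t; set x := expR t in x0 *.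
have h : 0 < x ^+ 2 by rewrite exprn_gt0.
rewrite expr_div_n ltr_pdivrMr ?mul1r; last by rewrite exprn_gt0// addr_gt0.
by rewrite -subr_gt0 (_ : _ - _ = 4 * x ^+ 2); [rewrite mulr_gt0 | ring].
Qed.

Lemma mul_ltN1 a b : a ^+ 2 < 1 -> b ^+ 2 < 1 -> 0 < 1 + a * b.
Proof. by move=> ha hb; nra. Qed.

Lemma tanhD s t : tanh (s + t) = (tanh s + tanh t) / (1 + tanh s * tanh t).
Proof.
have := mul_ltN1 (tanh_sqr_lt1 s) (tanh_sqr_lt1 t).
rewrite !tanh_expR expRD; have x0 := expR_gt0 s; have y0 := expR_gt0 t.
set x := expR s in x0 *; set y := expR t in y0 *.
have hx : 0 < x ^+ 2 + 1 by rewrite ltr_wpDl// sqr_ge0.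
have hy : 0 < y ^+ 2 + 1 by rewrite ltr_wpDl// sqr_ge0.
have hxy : 0 < (x * y) ^+ 2 + 1 by rewrite ltr_wpDl// sqr_ge0.
move=> h; field; rewrite !gt_eqF//.
rewrite (_ : _ + _ = 2 * ((x * y) ^+ 2 + 1)); last by ring.
by rewrite mulr_gt0.
Qed.

Lemma tanh_surj a : a ^+ 2 < 1 -> exists t, tanh t = a.
Proof.
move=> ha; have am : 0 < 1 - a by nra.
have ap : 0 < 1 + a by nra.
exists (ln (Num.sqrt ((1 + a) / (1 - a)))).
rewrite tanh_expR lnK ?posrE ?sqrtr_gt0 ?divr_gt0// sqr_sqrtr ?divr_ge0 ?ltW//.
by field; rewrite gt_eqF//= (_ : 1 + a + (1 - a) = 2)//; ring.
Qed.

Definition rot u q : quat R := u ** q ** qconj u.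
Definition cj e q : quat R := if e == 1 then q else qconj q.

(** Splits an element into conjugation, Moebius map, rotation and sign. The action law reduces to
    how these four commute with each other. *)
Lemma actE u e1 t e2 q :
  act (u, e1, t, e2) q = e1 *: rot u (mob (tanh t) (cj e2 q)).
Proof. by rewrite /act /cj /mob !qmulrl; case: ifP. Qed.

Lemma rotZ u k q : rot u (k *: q) = k *: rot u q.
Proof. by rewrite /rot qmulZr qmulZl. Qed.
Lemma rotD u p q : rot u (p + q) = rot u p + rot u q.
Proof. by rewrite /rot qmulDr qmulDl. Qed.
Lemma rotM u v q : rot u (rot v q) = rot (u ** v) q.
Proof. by rewrite /rot qconjM !qmulA. Qed.
Lemma rot_conj u q : rot u (qconj q) = qconj (rot u q).
Proof. by rewrite /rot !qconjM qconjK qmulA. Qed.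
Lemma rot_norm u q : qnorm2 u = 1 -> qnorm2 (rot u q) = qnorm2 q.
Proof. by move=> u1; rewrite /rot !qnorm2M qnorm2_conj u1 mulr1 mul1r. Qed.
Lemma rot_real u k : qnorm2 u = 1 -> rot u (qreal k) = qreal k.
Proof.
by move=> u1; rewrite /rot qmulrr qmulZl qmulC_conj u1 -qmulrl qmul1r.
Qed.
Lemma rot_re u q : qnorm2 u = 1 -> q0 (rot u q) = q0 q.
Proof.
move=> u1; transitivity (qnorm2 u * q0 q); last by rewrite u1 mul1r.
by rewrite /rot /qnorm2; qexpand; ring.
Qed.
Lemma rot_mob u a q : qnorm2 u = 1 -> mob a (rot u q) = rot u (mob a q).
Proof.
move=> u1; rewrite !mobE /mobN rot_norm// rot_re// rotZ !rotD rotZ.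
by rewrite rot_real// rot_conj.
Qed.

Lemma mob_conj a q : mob a (qconj q) = qconj (mob a q).
Proof.
rewrite !mobE /mobN qnorm2_conj qconjZ !qconjD qconjZ.
by congr (_ *: (_ + _ + _)); [congr (_^-1); qexpand | qring].
Qed.

Lemma qnorm2N q : qnorm2 (- q) = qnorm2 q.
Proof. by rewrite /qnorm2 !qcoordE !sqrrN. Qed.

Lemma mobNN a q : mob (- a) (- q) = - mob a q.
Proof.
rewrite !mobE /mobN qnorm2N q0N sqrrN !mulrN mulNr opprK.
by rewrite -scalerN; congr (_ *: _); qring.
Qed.

Lemma cj_mob e a q : cj e (mob a q) = mob a (cj e q).
Proof. by rewrite /cj; case: ifP; rewrite ?mob_conj. Qed.
Lemma cj_rot e u q : cj e (rot u q) = rot u (cj e q).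
Proof. by rewrite /cj; case: ifP; rewrite ?rot_conj. Qed.
Lemma cjZ e k q : cj e (k *: q) = k *: cj e q.
Proof. by rewrite /cj; case: ifP; rewrite ?qconjZ. Qed.
Lemma cj_norm e q : qnorm2 (cj e q) = qnorm2 q.
Proof. by rewrite /cj; case: ifP; rewrite ?qnorm2_conj. Qed.
Lemma cj_ball e q : qball q -> qball (cj e q).
Proof. by rewrite /qball/= cj_norm. Qed.

Lemma sign_neq : (-1 == 1 :> R) = false.
Proof. by apply/eqP; lra. Qed.

Lemma cj_cj e e' q : e = 1 \/ e = -1 -> e' = 1 \/ e' = -1 ->
  cj e (cj e' q) = cj (e * e') q.
Proof.
by case=> ->; case=> ->; rewrite /cj ?mulr1 ?mul1r ?mulrNN ?mulr1 ?eqxx ?sign_neq ?qconjK.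
Qed.

(** Source of the semidirect product: moving a sign across a Moebius map multiplies the parameter by
    that sign. The other commutations are untwisted. *)
Lemma mob_sign e a q : e = 1 \/ e = -1 -> mob a (e *: q) = e *: mob (e * a) q.
Proof.
case=> ->; first by rewrite !scale1r mul1r.
by rewrite !scaleN1r -mobNN mulN1r opprK.
Qed.

Lemma mob_tanh s t q : qball q -> mob (tanh s) (mob (tanh t) q) = mob (tanh (s + t)) q.
Proof.
move=> hq; rewrite tanhD mob_mob//.
- by rewrite gt_eqF// mul_ltN1// tanh_sqr_lt1.
- by rewrite gt_eqF// mobN_gt0// tanh_sqr_lt1.
- by rewrite -tanhD gt_eqF// mobN_gt0// tanh_sqr_lt1.
Qed.

Lemma sqr_sign e : e = 1 \/ e = -1 -> e ^+ 2 = 1.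
Proof. by case=> ->; rewrite ?sqrrN expr1n. Qed.

Lemma sign_norm e q : e = 1 \/ e = -1 -> qnorm2 (e *: q) = qnorm2 q.
Proof. by move=> /sqr_sign he; rewrite qnorm2Z he mul1r. Qed.

Lemma act_ball (x : grp R) q : in_grp x -> qball q -> qball (act x q).
Proof.
case: x => [[[u e1] t] e2] [u1 [he1 he2]] hq.
rewrite actE /qball /= sign_norm// rot_norm//.
exact: (mob_ball (tanh_sqr_lt1 t) (cj_ball e2 hq)).
Qed.

Lemma act1 q : act (grp_one R) q = q.
Proof.
by rewrite actE tanh0 mob0 /cj eqxx scale1r /rot qmul1l (_ : qconj _ = qreal 1) ?qmul1r//; qring.
Qed.

Lemma tanh_sign e t : e = 1 \/ e = -1 -> e * tanh t = tanh (e * t).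
Proof. by case=> ->; rewrite ?mul1r// !mulN1r tanhN. Qed.

Lemma act_mul (x y : grp R) q : in_grp x -> in_grp y -> qball q ->
  act (grp_mul x y) q = act x (act y q).
Proof.
case: x => [[[u e1] t] e2] [u1 [he1 he2]].
case: y => [[[u' e1'] t'] e2'] [u1' [he1' he2']] hq.
rewrite [grp_mul _ _]/= !actE cjZ mob_sign// cj_rot rot_mob// cj_mob.
rewrite tanh_sign// mob_tanh; last exact/cj_ball/cj_ball.
by rewrite cj_cj// rotZ rotM scalerA.
Qed.

(** The factor [e1] in the third component compensates the twist of [grp_mul]. *)
Definition grp_inv (x : grp R) : grp R :=
  let: (u, e1, t, e2) := x in (qconj u, e1, - (e1 * t), e2).

Lemma grp_inv_in (x : grp R) : in_grp x -> in_grp (grp_inv x).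
Proof.
case: x => [[[u e1] t] e2] [u1 [he1 he2]]; split => //.
by rewrite /Sp1 /= qnorm2_conj.
Qed.

Lemma grp_mul_in (x y : grp R) : in_grp x -> in_grp y -> in_grp (grp_mul x y).
Proof.
case: x => [[[u e1] t] e2] [u1 [he1 he2]].
case: y => [[[u' e1'] t'] e2'] [u1' [he1' he2']].
split; first by rewrite /Sp1 /= qnorm2M u1 u1' mulr1.
split; [case: he1 he1' | case: he2 he2'] => -> [] ->; lra.
Qed.

Lemma act_invr (x : grp R) q : in_grp x -> qball q -> act x (act (grp_inv x) q) = q.
Proof.
move=> hx hq; rewrite -act_mul//; last exact: grp_inv_in.
case: x hx => [[[u e1] t] e2] [u1 [he1 he2]].
rewrite [grp_mul _ _]/= qmulC_conj u1 subrr -!expr2 !sqr_sign//; exact: act1.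
Qed.

Lemma act_invl (x : grp R) q : in_grp x -> qball q -> act (grp_inv x) (act x q) = q.
Proof.
move=> hx hq; rewrite -act_mul//; last exact: grp_inv_in.
case: x hx => [[[u e1] t] e2] [u1 [he1 he2]].
rewrite [grp_mul _ _]/= qmul_conjC u1 mulrN mulrA -!expr2 !sqr_sign// mul1r addNr.
exact: act1.
Qed.

Definition is_act (f : quat R -> quat R) :=
  exists x : grp R, in_grp x /\ forall q, qball q -> f q = act x q.

(** Allows f to be normalized by the group, so that f 0 may be placed on the imaginary axis. *)
Lemma is_act_postcomp f (x : grp R) : in_grp x ->
  (forall q, qball q -> qball (f q)) -> is_act (act x \o f) -> is_act f.
Proof.
move=> hx hf [y [hy e]]; have hi := grp_inv_in hx.
exists (grp_mul (grp_inv x) y); split; first exact: grp_mul_in.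
by move=> q hq; rewrite act_mul// -e//= act_invl//; exact: hf.
Qed.

End GroupLaws.

(** * Smoothness of the action on the ball *)

Lemma near_eq_continuous (T U : topologicalType) (f g : T -> U) (x : T) :
  {near x, f =1 g} -> {for x, continuous f} -> {for x, continuous g}.
Proof.
move=> fg c; rewrite /prop_for /continuous_at -(nbhs_singleton fg).
exact: cvg_trans (near_eq_cvg fg) c.
Qed.

Lemma continuous_rV (R : realType) (T : topologicalType) n (F : T -> 'rV[R]_n) x :
  (forall i, {for x, continuous (fun y => F y ord0 i)}) -> {for x, continuous F}.
Proof.
move=> h; apply/cvgrPdist_le => /= e e0; near=> p.
rewrite /Num.Def.normr/= mx_normrE (bigmax_le _ (ltW e0))//= => -[i j] _.
rewrite !mxE/= (ord1 i); move: j; near: p; apply: filter_forall => /= j.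
exact: ((cvgrPdist_le _ _).1 (h j)).
Unshelve. all: by end_near. Qed.

Section Smoothness.
Variable R : realType.
Implicit Types (f g : quat R -> R) (F G : quat R -> quat R) (q v : quat R).

Let coord_continuous (i : 'I_4) : continuous (fun q : quat R => q ord0 i).
Proof. exact: coord_continuous. Qed.

Lemma qball_open : open (@qball R).
Proof.
have c : continuous (@qnorm2 R).
  rewrite (_ : @qnorm2 R = fun p => q0 p * q0 p + q1 p * q1 p +
      q2 p * q2 p + q3 p * q3 p); last by apply/funext => p; rewrite /qnorm2 !expr2.
  have cM (i : 'I_4) : continuous (fun p : quat R => p ord0 i * p ord0 i).
    by move=> q; apply: continuousM; exact: coord_continuous.
  have cD (f g : quat R -> R) : continuous f -> continuous g ->
    continuous (fun p => f p + g p) by move=> cf cg q; apply: continuousD; [exact: cf|exact: cg].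
  by apply: (cD _ _ (cD _ _ (cD _ _ _ _) _) _); exact: cM.
rewrite (_ : @qball R = @qnorm2 R @^-1` [set x | x < 1])//.
apply: open_comp => [q _|]; [exact: c | exact: open_lt].
Qed.

Lemma qball_near q : qball q -> \forall p \near q, qball p.
Proof. by move=> hq; exact: open_nbhs_nbhs (conj qball_open hq). Qed.

(** Class C^n on the ball, by recursion on the order instead of on a list of directions: closure
    under sums, products and inverses then follows by induction on n. *)
Fixpoint Cn (n : nat) f : Prop :=
  (forall q, qball q -> {for q, continuous f}) /\
  if n is n'.+1 then
    (forall v q, qball q -> derivable f q v) /\ (forall v, Cn n' ('D_v f))
  else True.

Lemma Cn_cont n f q : Cn n f -> qball q -> {for q, continuous f}.
Proof. by case: n => [|n] [h _]; exact: h. Qed.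

Lemma CnW n f : Cn n.+1 f -> Cn n f.
Proof.
elim: n f => [|n IH] f [c [d h]]; split=> //; split=> // v; exact: IH.
Qed.

(** The ball is open, so equality on it is local equality and passes to derivatives. The rules for
    derivatives of products and inverses are available on the ball only, hence the repeated use. *)
Lemma Cn_eq n f g : (forall q, qball q -> f q = g q) -> Cn n f -> Cn n g.
Proof.
have E f' g' q : (forall q, qball q -> f' q = g' q) -> qball q ->
    {near q, f' =1 g'}.
  by move=> e hq; apply: filterS (qball_near hq); exact: e.
have C f' g' : (forall q, qball q -> f' q = g' q) ->
    (forall q, qball q -> {for q, continuous f'}) ->
    forall q, qball q -> {for q, continuous g'}.
  by move=> e c q hq; apply: near_eq_continuous (c q hq); exact: E.
elim: n f g => [|n IH] f g e [c h]; split; try exact: C c; first by [].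
case: h => d h; split => [v q hq|v].
  by apply: near_eq_derivable (d v q hq); exact: E.
apply: IH (h v) => q hq; apply: near_eq_derive; exact: E.
Qed.

Lemma Cn_cst n (k : R) : Cn n (cst k).
Proof.
elim: n k => [|n IH] k; split=> //; try by move=> *; exact: cst_continuous.
split=> // v; rewrite (_ : 'D_v (cst k) = cst 0)//.
by apply/funext => q; rewrite derive_cst.
Qed.

Lemma is_derive_coord (i : 'I_4) q v :
  is_derive q v (fun p : quat R => p ord0 i) (v ord0 i).
Proof.
apply: DeriveDef; first by have /derivable_mxP := @derivable_id _ _ q v; exact.
have := @derive_id _ _ q v; rewrite derive_mx//.
by move/rowP/(_ i); rewrite mxE.
Qed.

Lemma Cn_coord n (i : 'I_4) : Cn n (fun q => q ord0 i).
Proof.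
case: n => [|n]; split=> //; try by move=> *; exact: coord_continuous.
split=> v; first by move=> q _; have [] := is_derive_coord i q v.
rewrite (_ : 'D_v _ = cst (v ord0 i)); first exact: Cn_cst.
by apply/funext => q; have [] := is_derive_coord i q v.
Qed.

Lemma CnD n f g : Cn n f -> Cn n g -> Cn n (fun q => f q + g q).
Proof.
elim: n f g => [|n IH] f g [cf hf] [cg hg]; split=> //.
- by move=> q hq; apply: continuousD; [exact: cf | exact: cg].
- by move=> q hq; apply: continuousD; [exact: cf | exact: cg].
case: hf hg => df hf [dg hg]; split=> [v q hq|v].
  by apply: derivableD; [exact: df | exact: dg].
apply: (Cn_eq _ (IH _ _ (hf v) (hg v))) => q hq.
by rewrite -deriveD//; [exact: df | exact: dg].
Qed.

Lemma CnM n f g : Cn n f -> Cn n g -> Cn n (fun q => f q * g q).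
Proof.
elim: n f g => [|n IH] f g nf ng.
  case: nf ng => [cf _] [cg _]; split=> // q hq.
  by apply: continuousM; [exact: cf | exact: cg].
have [nf' ng'] := (CnW nf, CnW ng); case: nf ng => [cf [df hf]] [cg [dg hg]].
split; first by move=> q hq; apply: continuousM; [exact: cf | exact: cg].
split=> [v q hq|v]; first by apply: derivableM; [exact: df | exact: dg].
apply: (Cn_eq _ (CnD (IH _ _ nf' (hg v)) (IH _ _ ng' (hf v)))) => q hq.
by rewrite [RHS](deriveM (df v q hq) (dg v q hq)).
Qed.

Lemma CnN n f : Cn n f -> Cn n (fun q => - f q).
Proof.
move=> h; apply: (Cn_eq _ (CnM (Cn_cst n (-1)) h)) => q _ /=.
by rewrite mulN1r.
Qed.

(** The derivative of 1/f is - (1/f) (1/f) f', a product to which the induction hypothesis for 1/f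
    applies. *)
Lemma CnV n f : (forall q, qball q -> f q != 0) -> Cn n f ->
  Cn n (fun q => (f q)^-1).
Proof.
move=> f0; have c : (forall q, qball q -> {for q, continuous f}) ->
    forall q, qball q -> {for q, continuous (fun q => (f q)^-1)}.
  by move=> cf q hq; apply: continuousV; [exact: f0 | exact: cf].
elim: n => [|n IH] h; first by case: h => [cf _]; split=> //; exact: c.
have IH' := IH (CnW h); case: h => [cf [df hf]]; split; first exact: c.
split=> [v q hq|v]; first by apply: derivableV; [exact: f0 | exact: df].
apply: (Cn_eq _ (CnN (CnM (CnM IH' IH') (hf v)))) => q hq.
by rewrite [RHS](deriveV (f0 q hq) (df v q hq)) -expr2 exprVn scaleNr.
Qed.

Definition smooth_coord F := forall n (i : 'I_4), Cn n (fun q => F q ord0 i).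

Lemma smooth_coord_derivable F v q : smooth_coord F -> qball q ->
  derivable F q v.
Proof.
move=> h hq; apply/derivable_mxP => i j; rewrite (ord1 i).
by have [_ [+ _]] := h 1%N j; exact.
Qed.

Lemma smooth_coord_derive F v : smooth_coord F -> smooth_coord ('D_v F).
Proof.
move=> h n i; have [_ [_ /(_ v)]] := h n.+1 i; apply: Cn_eq => q hq.
by rewrite derive_mx ?mxE//; exact: smooth_coord_derivable.
Qed.

Lemma smooth_coord_on F : smooth_coord F -> smooth_on (@qball R) F.
Proof.
move=> h vs; have {h} : smooth_coord (iter_D vs F).
  by elim: vs => [|v vs IH] //=; exact: smooth_coord_derive.
move: (iter_D vs F) => G h; split=> [q hq|v q hq]; last first.
  exact: smooth_coord_derivable.
by apply: continuous_rV => i; exact: Cn_cont (h 0%N i) hq.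
Qed.

Lemma smooth_on_eq F G : (forall q, qball q -> F q = G q) ->
  smooth_on (@qball R) F -> smooth_on (@qball R) G.
Proof.
move=> e h vs.
have {}e q : qball q -> iter_D vs F q = iter_D vs G q.
  elim: vs q => [|v vs IH] q hq /=; first exact: e.
  by apply: near_eq_derive; apply: filterS (qball_near hq); exact: IH.
have [hc hd] := h vs; split=> [q hq|v q hq].
  apply: near_eq_continuous (hc q hq).
  by apply: filterS (qball_near hq); exact: e.
apply: near_eq_derivable (hd v q hq).
by apply: filterS (qball_near hq); exact: e.
Qed.

Lemma smooth_coordP F : (forall n, [/\ Cn n (fun q => q0 (F q)),
  Cn n (fun q => q1 (F q)), Cn n (fun q => q2 (F q)) & Cn n (fun q => q3 (F q))]) ->
  smooth_coord F.
Proof.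
move=> h n i; have [h0 h1 h2 h3] := h n.
have -> : i = inord i by rewrite inord_val.
by case: i => -[|[|[|[|//]]]] /=.
Qed.

Lemma smooth_coord_id : smooth_coord id.
Proof. by move=> n i; exact: Cn_coord. Qed.

Lemma smooth_coord_cst (p : quat R) : smooth_coord (cst p).
Proof. by move=> n i; exact: Cn_cst. Qed.

Lemma smooth_coordD F G : smooth_coord F -> smooth_coord G ->
  smooth_coord (fun q => F q + G q).
Proof.
by move=> hF hG n i; apply: Cn_eq (CnD (hF n i) (hG n i)) => q _; rewrite mxE.
Qed.

Lemma smooth_coordZ f F : (forall n, Cn n f) -> smooth_coord F ->
  smooth_coord (fun q => f q *: F q).
Proof.
by move=> hf hF n i; apply: Cn_eq (CnM (hf n) (hF n i)) => q _; rewrite mxE.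
Qed.

Lemma smooth_coordM F G : smooth_coord F -> smooth_coord G ->
  smooth_coord (fun q => qmul (F q) (G q)).
Proof.
move=> hF hG; apply: smooth_coordP => n.
(* The first function of [Cn_eq] is left open; [reflexivity] instantiates it with the coordinate
   polynomial of the product. *)
split; (apply: Cn_eq; first by move=> q _; symmetry; rewrite /qmul ?qcoordE; reflexivity);
  do ?[apply: CnD|apply: CnN|apply: CnM];
  first [exact: hF|exact: hG].
Qed.

Lemma smooth_coord_conj F : smooth_coord F ->
  smooth_coord (fun q => qconj (F q)).
Proof.
move=> hF; apply: smooth_coordP => n.
split; (apply: Cn_eq; first by move=> q _; symmetry; rewrite /qconj ?qcoordE; reflexivity);
  try apply: CnN; exact: hF.
Qed.

Lemma Cn_norm F : smooth_coord F -> forall n, Cn n (fun q => qnorm2 (F q)).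
Proof.
move=> hF n.
apply: Cn_eq; first by move=> q _; symmetry; rewrite /qnorm2 !expr2; reflexivity.
by do ?apply: CnD; apply: CnM; exact: hF.
Qed.

Lemma mobF_smooth a F : a ^+ 2 < 1 -> smooth_coord F ->
  (forall q, qball q -> qball (F q)) -> smooth_coord (fun q => mob a (F q)).
Proof.
move=> ha hF hb.
apply: smooth_coordM; last first.
  by apply: smooth_coordD => //; exact: smooth_coord_cst.
have h : smooth_coord (fun q => qreal 1 + a *: F q).
  apply: smooth_coordD; first exact: smooth_coord_cst.
  by apply: smooth_coordZ => // n; exact: Cn_cst.
apply: smooth_coordZ; last exact: smooth_coord_conj.
move=> n; apply: CnV; last exact: Cn_norm.
by move=> q hq; rewrite mobNE gt_eqF// mobN_gt0//; exact: hb.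
Qed.

Lemma act_smooth (x : grp R) : in_grp x -> smooth_coord (act x).
Proof.
case: x => [[[u e1] t] e2] [u1 [he1 he2]].
rewrite (_ : act _ = fun q => e1 *: rot u (mob (tanh t) (cj e2 q))); last first.
  by apply/funext => q; exact: actE.
apply: smooth_coordZ; first by move=> n; exact: Cn_cst.
apply: smooth_coordM; last exact: smooth_coord_cst.
apply: smooth_coordM; first exact: smooth_coord_cst.
apply: mobF_smooth => [||q hq]; [exact: tanh_sqr_lt1 | | exact: cj_ball].
rewrite /cj; case: (e2 == 1); first exact: smooth_coord_id.
by apply: smooth_coord_conj; exact: smooth_coord_id.
Qed.

End Smoothness.

(** * From continuous directional derivatives to differentiability *)

Section Differentiability.
Variable R : realType.

Lemma is_derive_line (V W : normedModType R) (f : V -> W) (p v : V) (s : R) (d : W) :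
  is_derive (s *: v + p) v f d -> is_derive s 1 (fun t : R => f (t *: v + p)) d.
Proof.
move=> [h1 h2].
have E : (fun h : R => h^-1 *: (f ((h *: (1 : R) + s) *: v + p) - f (s *: v + p))) =
         (fun h : R => h^-1 *: (f (h *: v + (s *: v + p)) - f (s *: v + p))).
  by apply/funext => h; rewrite [h *: 1]mulr1 scalerDl addrA.
apply: DeriveDef; first by move: h1; rewrite /derivable /= -E.
by move: h2; rewrite /derive /= -E.
Qed.

Lemma coord_le_norm n (h : 'rV[R]_n) (i : 'I_n) : `|h ord0 i| <= `|h|.
Proof.
rewrite [leRHS]/Num.Def.normr/= mx_normrE.
by apply: le_trans; last exact: (le_bigmax _ _ (ord0, i)).
Qed.

(** Mean value theorem on the segment from p to c v + p. The sign of c decides the orientation of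
    the interval. *)
Lemma derive_approx (V : normedModType R) (f : V -> R) (p v : V) (c d e : R) :
  (forall s : R, `|s| <= `|c| -> derivable f (s *: v + p) v /\
     `|'D_v f (s *: v + p) - d| <= e) ->
  `|f (c *: v + p) - f p - c * d| <= e * `|c|.
Proof.
move=> h.
have dl (s : R) : `|s| <= `|c| ->
    is_derive s (1 : R) (fun t : R => f (t *: v + p)) ('D_v f (s *: v + p)).
  move=> hs; apply: is_derive_line; apply: DeriveDef => //; exact: (h s hs).1.
have cl (s : R) : `|s| <= `|c| -> {for s, continuous (fun t : R => f (t *: v + p))}.
  move=> hs; apply/differentiable_continuous/derivable1_diffP.
  by have [] := dl s hs.
have fp : f p = f (0 *: v + p) by rewrite scale0r add0r.
have [c0|c0|->] := ltgtP c 0; last by rewrite -fp subrr mul0r subrr normr0 mulr0.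
- have lc s : s \in `[c, 0]%R -> `|s| <= `|c|.
    by rewrite in_itv /= => /andP[s1 s2]; rewrite !ler0_norm ?lerN2// ltW.
  have [| |x xi] := MVT c0 (f := fun t : R => f (t *: v + p)) (df := fun t : R => 'D_v f (t *: v + p)).
  + by move=> x xi; apply: dl; apply: lc; exact: subset_itv_oo_cc xi.
  + by apply: continuous_in_subspaceT => x; rewrite inE => xi; exact/cl/lc.
  + have xc := lc x (subset_itv_oo_cc xi); rewrite fp => E.
    have -> : f (c *: v + p) - f (0 *: v + p) - c * d = c * ('D_v f (x *: v + p) - d).
      by move: E; rewrite sub0r => /(congr1 -%R); rewrite opprB => ->; ring.
    by rewrite normrM mulrC ler_wpM2r//; exact: (h x xc).2.
- have lc s : s \in `[0, c]%R -> `|s| <= `|c|.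
    by rewrite in_itv /= => /andP[s1 s2]; rewrite !ger0_norm// ltW.
  have [| |x xi] := MVT c0 (f := fun t : R => f (t *: v + p)) (df := fun t : R => 'D_v f (t *: v + p)).
  + by move=> x xi; apply: dl; apply: lc; exact: subset_itv_oo_cc xi.
  + by apply: continuous_in_subspaceT => x; rewrite inE => xi; exact/cl/lc.
  + have xc := lc x (subset_itv_oo_cc xi); rewrite fp => E.
    have -> : f (c *: v + p) - f (0 *: v + p) - c * d = c * ('D_v f (x *: v + p) - d).
      by rewrite E; ring.
    by rewrite normrM mulrC ler_wpM2r//; exact: (h x xc).2.
Qed.

Lemma differentiable_linear_approx (V W : normedModType R) (f : V -> W)
    (L : {linear V -> W}) (x : V) : continuous L ->
  (forall e : R, 0 < e -> exists2 r : R, 0 < r &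
     forall h, `|h| < r -> `|f (h + x) - f x - L h| <= e * `|h|) ->
  differentiable f x.
Proof.
move=> Lc H; suff E : f \o shift x = cst (f x) + L +o_ 0 id.
  by apply/diff_locallyP; rewrite (diff_unique Lc E).
apply/eqaddoP => e e0; have [r r0 Hr] := H e e0; near=> h.
have /Hr : `|h| < r by near: h; exact: nbhs0_lt.
by rewrite /= !fctE opprD addrA.
Unshelve. all: by end_near.
Qed.

Lemma near_forall_ball (V : normedModType R) n (x : V) (P : 'I_n -> V -> Prop) :
  (forall i, \forall y \near x, P i y) ->
  exists2 r : R, 0 < r & forall y, `|x - y| < r -> forall i, P i y.
Proof.
move=> H; have : \forall y \near x, forall i, P i y by apply: filter_forall.
by move=> /nbhs_ballP[r /= r0 Hr]; exists r => // y xy; apply: Hr; rewrite -ball_normE.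
Qed.

Lemma near_partial_close (V : normedModType R) (f : V -> R) (x v : V) (e : R) :
  0 < e -> (\forall y \near x, derivable f y v) -> {for x, continuous ('D_v f)} ->
  \forall y \near x, derivable f y v /\ `|'D_v f y - 'D_v f x| <= e.
Proof.
move=> e0 fd /cvgrPdist_le/(_ e e0) fc; apply: filterS2 fd fc => y h1 h2.
by split=> //; rewrite distrC.
Qed.

Section Grad.
Variables (n : nat) (g : 'rV[R]_n).
Definition grad_lin (h : 'rV[R]_n) : R := \sum_i h ord0 i * g ord0 i.
Lemma grad_lin_linear : linear grad_lin.
Proof.
move=> k u w; rewrite /grad_lin scaler_sumr -big_split/=; apply: eq_bigr => i _.
by rewrite !mxE mulrDl -mulrA.
Qed.
HB.instance Definition _ := GRing.isLinear.Build R _ _ _ grad_lin grad_lin_linear.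
Lemma grad_lin_continuous : continuous grad_lin.
Proof.
move=> x; rewrite (_ : grad_lin = \sum_i (fun h : 'rV[R]_n => g ord0 i *: h ord0 i)).
  by apply/differentiable_continuous/differentiable_sum => i;
     apply/differentiableZ/differentiable_coord.
by apply/funext => h; rewrite fct_sumE; apply: eq_bigr => i _; rewrite mulrC.
Qed.
End Grad.

(* Telescope along the coordinates of the increment. *)
Lemma differentiable_partial n (f : 'rV[R]_n -> R) (x : 'rV[R]_n) :
  (forall i, \forall y \near x, derivable f y (delta_mx ord0 i)) ->
  (forall i, {for x, continuous ('D_(delta_mx ord0 i) f)}) ->
  differentiable f x.
Proof.
move=> fd fc.
pose g : 'rV[R]_n := \row_i 'D_(delta_mx ord0 i) f x.
pose L : {linear 'rV[R]_n -> R} := grad_lin g.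
have Lc : continuous L by exact: grad_lin_continuous.
apply: (@differentiable_linear_approx _ _ f L x Lc) => e e0.
(* The n coordinates contribute at most e' |h| each; dividing by n + 1 also covers n = 0. *)
pose e' := e / n.+1%:R.
have e'0 : 0 < e' by rewrite divr_gt0.
have [r r0 Hr] := near_forall_ball (fun i => near_partial_close e'0 (fd i) (fc i)).
exists r => // h hr.
(* The increment truncated to its first k coordinates; passing from k to k + 1 moves along a single
   basis vector. *)
pose w (k : nat) : 'rV[R]_n := \row_j (if (j < k)%N then h ord0 j else 0).
have ws (k : 'I_n) : w k.+1 = h ord0 k *: delta_mx ord0 k + w k.
  apply/rowP => j; rewrite !mxE eqxx /= ltnS leq_eqVlt -(inj_eq val_inj j k).
  by case: (ltngtP (val j) (val k)) => [jk|jk|/val_inj ->];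
     rewrite ?mulr0 ?add0r ?mulr1 ?addr0.
have w0 : w 0%N = 0 by apply/rowP => j; rewrite !mxE.
have wn : w n = h by apply/rowP => j; rewrite !mxE ltn_ord.
have -> : f (h + x) - f x - L h =
    \sum_(k < n) (f (w k.+1 + x) - f (w k + x) - h ord0 k * 'D_(delta_mx ord0 k) f x).
  rewrite sumrB -(big_mkord xpredT (fun k => f (w k.+1 + x) - f (w k + x))).
  by rewrite telescope_sumr// wn w0 add0r; congr (_ - _); apply: eq_bigr => k _; rewrite mxE.
apply: le_trans (ler_norm_sum _ _ _) _.
apply: (@le_trans _ _ (\sum_(k < n) e' * `|h|)).
  apply: ler_sum => k _; rewrite ws -[_ + _ + x]addrA.
  apply: le_trans (ler_wpM2l (ltW e'0) (coord_le_norm h k)).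
  apply: derive_approx => s sk; apply: Hr.
  (* In the max norm every point of the path stays within |h| of x, since each coordinate of its
     displacement is bounded by that of h. *)
  rewrite addrA opprD addrCA subrr addr0 normrN; apply: le_lt_trans hr.
  rewrite [leLHS]/Num.Def.normr/= mx_normrE (bigmax_le _ (normr_ge0 _))//= => -[i j] _.
  rewrite !mxE (ord1 i) eqxx /=; have [jk|jk|/val_inj ->] := ltngtP (val j) (val k).
  - by rewrite -(inj_eq val_inj) (ltn_eqF jk) mulr0 add0r coord_le_norm.
  - by rewrite -(inj_eq val_inj) (gtn_eqF jk) mulr0 add0r normr0.
  - by rewrite eqxx mulr1 addr0 (le_trans sk)// coord_le_norm.
rewrite sumr_const card_ord -mulrnAl ler_wpM2r// /e' -mulr_natr -mulrA.
by rewrite ler_piMr ?(ltW e0)// mulrC ler_pdivrMr// mul1r ler_nat leqnSn.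
Qed.

Lemma differentiable_C1_rV (m n : nat) (F : 'rV[R]_n -> 'rV[R]_m) (A : set 'rV[R]_n) x :
  open A -> A x -> (forall v y, A y -> derivable F y v) ->
  (forall v, {for x, continuous ('D_v F)}) -> differentiable F x.
Proof.
move=> oA Ax Fd Fc; have nA : \forall y \near x, A y by exact: open_nbhs_nbhs (conj oA Ax).
rewrite (_ : F = \sum_(i < m) (fun y => F y ord0 i *: delta_mx ord0 i)); last first.
  by apply/funext => y; rewrite fct_sumE [LHS]row_sum_delta.
apply: differentiable_sum => i; apply: differentiableZl.
apply: differentiable_partial => j.
  by apply: filterS nA => y Ay; have /derivable_mxP := Fd (delta_mx ord0 j) y Ay; exact.
have c : {for x, continuous (fun y => 'D_(delta_mx ord0 j) F y ord0 i)}.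
  have cc := @coord_continuous R 1 m ord0 i ('D_(delta_mx ord0 j) F x).
  exact: continuous_comp (Fc (delta_mx ord0 j)) cc.
apply: near_eq_continuous c; apply: filterS nA => y Ay.
by rewrite derive_mx ?mxE//; exact: Fd.
Qed.

(** The empty list of directions gives derivability, the one-element lists give continuity of the
    first derivatives. *)
Lemma smooth_on_differentiable (F : quat R -> quat R) q :
  smooth_on (@qball R) F -> qball q -> differentiable F q.
Proof.
move=> sF hq; apply: (differentiable_C1_rV (@qball_open R) hq).
  by move=> v y hy; exact: (sF [::]).2.
by move=> v; exact: (sF [:: v]).1.
Qed.

(** Carathéodory's form of the derivative: an exact factorization of the increment makes it
    unnecessary to differentiate a quaternionic fraction. *)
Lemma is_derive_increment (V W : normedModType R) (f G : V -> W) (A : set V) (x v : V) :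
  (forall h : R, A (h *: v + x) -> f (h *: v + x) - f x = h *: G (h *: v + x)) ->
  (\forall y \near x, A y) -> {for x, continuous G} -> is_derive x v f (G x).
Proof.
move=> fG nA cG.
have cl : (h *: v + x) @[h --> (0 : R)^'] --> x.
  apply: cvg_within_filter.
  have : {for (0 : R), continuous (fun h : R => h *: v + x)}.
    by apply: cvgD; [apply: cvgZr_tmp; exact: cvg_id | exact: cvg_cst].
  by rewrite /prop_for /continuous_at scale0r add0r.
suff H : h^-1 *: (f (h *: v + x) - f x) @[h --> (0 : R)^'] --> G x.
  by apply: DeriveDef; [apply/cvg_ex; exists (G x) | apply/cvg_lim].
apply: cvg_trans (cvg_comp _ _ cl cG); apply: near_eq_cvg; near=> h.
rewrite /= fG; last by near: h; exact: cl.
rewrite scalerA mulVf ?scale1r//; near: h; exact: nbhs_dnbhs_neq.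
Unshelve. all: by end_near. Qed.

End Differentiability.

(** * The action preserves the slice metric *)

Section ActIsometry.
Variable R : realType.
Implicit Types (p q r u v : quat R) (a k t e : R).

Local Notation "p ** q" := (qmul p q) (at level 40, left associativity).

Definition pinv a q : quat R := qinv (qreal 1 + a *: q).

Lemma qmulV p : qnorm2 p != 0 -> p ** qinv p = qreal 1.
Proof.
by move=> p0; rewrite /qinv qmulZr qmulC_conj -qmulrl; apply: quatP;
  rewrite /qmul /qreal !qcoordE; field.
Qed.

Lemma qVmul p : qnorm2 p != 0 -> qinv p ** p = qreal 1.
Proof.
by move=> p0; rewrite /qinv qmulZl qmul_conjC -qmulrl; apply: quatP;
  rewrite /qmul /qreal !qcoordE; field.
Qed.

(** Both factors are real combinations of 1, q and conj(q), so they commute. *)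
Lemma mobC a q : mob a q = (q + qreal a) ** pinv a q.
Proof. by rewrite /mob /pinv /qinv qmulZr qmulZl; congr (_ *: _); qring. Qed.

Lemma pinvK a q : mobN a q != 0 -> pinv a q ** (qreal 1 + a *: q) = qreal 1.
Proof. by move=> N0; rewrite qVmul// mobNE. Qed.

Lemma pinvKr a q : mobN a q != 0 -> (qreal 1 + a *: q) ** pinv a q = qreal 1.
Proof. by move=> N0; rewrite qmulV// mobNE. Qed.

(** M(p) is written as a right fraction and M(q) as a left one. Over the common denominators there
    remains (1 + a q)(p + a) - (q + a)(1 + a p), in which the terms in q p cancel. *)
Lemma mobB a p q : mobN a p != 0 -> mobN a q != 0 ->
  mob a p - mob a q = (1 - a ^+ 2) *: (pinv a q ** (p - q) ** pinv a p).
Proof.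
move=> Np Nq; rewrite mobC [mob a q]/mob -/(pinv a q).
pose X := (qreal 1 + a *: q) ** (p + qreal a).
pose Y := (q + qreal a) ** (qreal 1 + a *: p).
have eX : pinv a q ** X ** pinv a p = (p + qreal a) ** pinv a p.
  by rewrite /X qmulA pinvK// qmul1l.
have eY : pinv a q ** Y ** pinv a p = pinv a q ** (q + qreal a).
  by rewrite /Y -!qmulA pinvKr// qmul1r.
rewrite -eX -eY -qmulBl -qmulBr -qmulZl -qmulZr; congr (_ ** _ ** _).
by rewrite /X /Y; qring.
Qed.

(** The factor of the increment from q to p in [actB]; at p = q it is the differential at q in the
    direction v. Keeping p apart from q is what [is_derive_increment] asks for. *)
Definition dact (x : grp R) q v p : quat R :=
  let: (u, e1, t, e2) := x in
  e1 *: rot u ((1 - tanh t ^+ 2) *: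
    (pinv (tanh t) (cj e2 q) ** cj e2 v ** pinv (tanh t) (cj e2 p))).

Lemma cjB e p q : cj e (p - q) = cj e p - cj e q.
Proof. by rewrite /cj; case: ifP => // _; qring. Qed.

Lemma rotB u p q : rot u (p - q) = rot u p - rot u q.
Proof. by rewrite /rot qmulBr qmulBl. Qed.

Lemma dactZ (x : grp R) q v p k : dact x q (k *: v) p = k *: dact x q v p.
Proof.
case: x => [[[u e1] t] e2] /=.
by rewrite cjZ qmulZr qmulZl !rotZ !scalerA; congr (_ *: _); ring.
Qed.

Lemma actB (x : grp R) p q : in_grp x -> qball p -> qball q ->
  act x p - act x q = dact x q (p - q) p.
Proof.
case: x => [[[u e1] t] e2] [u1 [he1 he2]] hp hq.
rewrite !actE /dact -scalerBr -rotB cjB mobB//; rewrite gt_eqF// mobN_gt0//;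
  solve [exact: tanh_sqr_lt1 | exact: cj_ball].
Qed.

Lemma dact_smooth (x : grp R) q v : in_grp x -> smooth_coord (dact x q v).
Proof.
case: x => [[[u e1] t] e2] [u1 [he1 he2]] /=.
apply: smooth_coordZ; first by move=> n; exact: Cn_cst.
apply: smooth_coordM; last exact: smooth_coord_cst.
apply: smooth_coordM; first exact: smooth_coord_cst.
apply: smooth_coordZ; first by move=> n; exact: Cn_cst.
apply: smooth_coordM; first exact: smooth_coord_cst.
have hc : smooth_coord (cj e2 : quat R -> quat R).
  rewrite /cj; case: (e2 == 1); first exact: smooth_coord_id.
  by apply: smooth_coord_conj; exact: smooth_coord_id.
have h : smooth_coord (fun p => qreal 1 + tanh t *: cj e2 p).
  apply: smooth_coordD; first exact: smooth_coord_cst.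
  by apply: smooth_coordZ => // n; exact: Cn_cst.
apply: smooth_coordZ; last exact: smooth_coord_conj.
move=> n; apply: CnV; last exact: Cn_norm.
move=> p hp; rewrite mobNE gt_eqF// mobN_gt0//; first exact: tanh_sqr_lt1.
exact: cj_ball.
Qed.

Lemma is_derive_act (x : grp R) q v : in_grp x -> qball q ->
  is_derive q v (act x) (dact x q v q).
Proof.
move=> hx hq; apply: (is_derive_increment (A := @qball R)).
- by move=> h hh; rewrite actB// addrK dactZ.
- exact: qball_near.
- apply: continuous_rV => i; exact: Cn_cont (dact_smooth q v hx 0%N i) hq.
Qed.

Lemma slice_g_sign e q u v : e ^+ 2 = 1 ->
  slice_g (e *: q) (e *: u) (e *: v) = slice_g q u v.
Proof.
move=> e2; rewrite !slice_gE /qden.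
have E w : qslice (e *: q) (e *: w) = e *: qslice q w.
  rewrite /qslice (_ : (e *: q) ** _ ** _ = (e ^+ 2 * e) *: (q ** w ** q)).
    by rewrite e2 mul1r scalerBr.
  by qring.
rewrite !E qdotZ qnorm2Z (_ : (e *: q) ** (e *: q) = e ^+ 2 *: (q ** q)).
  by rewrite e2 scale1r !mul1r.
by qring.
Qed.

Lemma qdot_conj u v : qdot (qconj u) (qconj v) = qdot u v.
Proof. by rewrite /qdot; qexpand; ring. Qed.

Lemma slice_g_cj e q u v : slice_g (cj e q) (cj e u) (cj e v) = slice_g q u v.
Proof.
rewrite /cj; case: ifP => // _; rewrite !slice_gE /qden.
have E w : qslice (qconj q) (qconj w) = qconj (qslice q w).
  by rewrite /qslice; qring.
rewrite !E qdot_conj qnorm2_conj; congr (_ / (_ * _)).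
by rewrite -[RHS]qnorm2_conj; congr qnorm2; qring.
Qed.

Lemma rot_mul u p q : qnorm2 u = 1 -> rot u (p ** q) = rot u p ** rot u q.
Proof.
move=> u1; rewrite /rot !qmulA -(qmulA (u ** p) (qconj u) u) qmul_conjC u1.
by rewrite qmul1r.
Qed.

Lemma qdot_rot u p q : qnorm2 u = 1 -> qdot (rot u p) (rot u q) = qdot p q.
Proof. by move=> u1; rewrite /rot qdotMr qdotMl qnorm2_conj u1 !mul1r. Qed.

Lemma slice_g_rot w q u v : qnorm2 w = 1 ->
  slice_g (rot w q) (rot w u) (rot w v) = slice_g q u v.
Proof.
move=> w1; rewrite !slice_gE /qden /qslice -!rot_mul// -!rotB qdot_rot//.
by rewrite -{1}(rot_real 1 w1) -rotB !rot_norm.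
Qed.

(** Used with m = M(q), p = (1 + a q)^-1 and x = q + a: it collects all inverses on the outside
    although w commutes with nothing. *)
Lemma qmul_sandwich (m p x w : quat R) : m = p ** x -> m = x ** p ->
  m ** (p ** w ** p) ** m = p ** p ** (x ** w ** x) ** (p ** p).
Proof.
move=> m1 m2; have l : m ** p = p ** p ** x by rewrite m1 -!qmulA -m2 m1.
have r : p ** m = x ** p ** p by rewrite -m2 m1 -[RHS]qmulA -m2 -m1.
transitivity ((m ** p) ** w ** (p ** m)); first by rewrite !qmulA.
by rewrite l r !qmulA.
Qed.

(** With A = 1 + a q and P = A^-1 the key identity is A w A - (q + a) w (q + a) = (1 - a^2) (w - q w
    q). Multiplied by P^2 on both sides it transforms [qslice]; for w = 1, multiplied by P on both
    sides, it transforms [qden]. The powers of |P| and 1 - a^2 then cancel. *)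
Lemma slice_g_mob a q u v : a ^+ 2 < 1 -> qball q ->
  slice_g (mob a q) ((1 - a ^+ 2) *: (pinv a q ** u ** pinv a q))
     ((1 - a ^+ 2) *: (pinv a q ** v ** pinv a q)) = slice_g q u v.
Proof.
move=> ha hq; have N0 := mobN_gt0 ha hq; have Nn : mobN a q != 0 by rewrite gt_eqF.
set P := pinv a q; set m := 1 - a ^+ 2; set A := qreal 1 + a *: q.
have PA : P ** A = qreal 1 by exact: pinvK.
have AP : A ** P = qreal 1 by exact: pinvKr.
have nP : qnorm2 P = (mobN a q)^-1.
  by rewrite /P /pinv /qinv qnorm2Z qnorm2_conj mobNE; field.
have m0 : 0 < m by rewrite subr_gt0.
have M1 : mob a q = P ** (q + qreal a) by [].
have M2 : mob a q = (q + qreal a) ** P by exact: mobC.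
clearbody P.
have E w : qslice (mob a q) (m *: (P ** w ** P)) =
    m ^+ 2 *: (P ** P ** qslice q w ** (P ** P)).
  have -> : m ^+ 2 *: (P ** P ** qslice q w ** (P ** P)) =
     m *: (P ** P ** (A ** w ** A - (q + qreal a) ** w ** (q + qreal a)) ** (P ** P)).
    have -> : A ** w ** A - (q + qreal a) ** w ** (q + qreal a) = m *: qslice q w.
      by rewrite /A /m /qslice; qring.
    by rewrite qmulZr qmulZl scalerA.
  rewrite qmulBr qmulBl /qslice qmulZr qmulZl -scalerBr; congr (_ *: (_ - _)).
    by rewrite !qmulA -(qmulA P P A) PA qmul1r -!qmulA (qmulA A P P) AP qmul1l.
  exact: qmul_sandwich.
have D : qden (mob a q) = m ^+ 2 * qnorm2 P ^+ 2 * qden q.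
  rewrite /qden.
  have -> : qreal 1 - mob a q ** mob a q =
      P ** (A ** A - (q + qreal a) ** (q + qreal a)) ** P.
    rewrite qmulBr qmulBl; congr (_ - _); last by rewrite {1}M1 M2 !qmulA.
    by rewrite !qmulA PA qmul1l AP.
  have -> : A ** A - (q + qreal a) ** (q + qreal a) = m *: (qreal 1 - q ** q).
    by rewrite /A /m; qring.
  by rewrite qmulZr qmulZl qnorm2Z !qnorm2M; ring.
rewrite !slice_gE !E qdotZ qdotMr qdotMl D mob_norm// !qnorm2M nP -/m.
field.
by rewrite Nn [m == 0]gt_eqF// [qden q == 0]gt_eqF ?qden_gt0// andbT gt_eqF// subr_gt0.
Qed.

Lemma slice_g_act (x : grp R) q u v : in_grp x -> qball q ->
  slice_g (act x q) (dact x q u q) (dact x q v q) = slice_g q u v.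
Proof.
case: x => [[[w e1] t] e2] [w1 [he1 he2]] hq.
rewrite actE /dact slice_g_sign; last exact: sqr_sign.
rewrite slice_g_rot// slice_g_mob ?slice_g_cj//.
  exact: tanh_sqr_lt1.
exact: cj_ball.
Qed.

Lemma act_slice_isometry (x : grp R) : in_grp x -> slice_isometry (act x).
Proof.
move=> hx; have hi := grp_inv_in hx; split.
- exact/smooth_coord_on/act_smooth.
- by move=> q; exact: act_ball.
- exists (act (grp_inv x)); split.
  + exact/smooth_coord_on/act_smooth.
  + by move=> q; exact: act_ball.
  + by move=> q; exact: act_invl.
  + by move=> q; exact: act_invr.
- move=> q u v hq; have [_ ->] := is_derive_act u hx hq.
  by have [_ ->] := is_derive_act v hx hq; exact: slice_g_act.
Qed.

Lemma slice_isometry_eq (f g : quat R -> quat R) :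
  (forall q, qball q -> f q = g q) -> slice_isometry f -> slice_isometry g.
Proof.
move=> e [sf fb [h [sh hb hf fh]] fg]; split.
- exact: smooth_on_eq e sf.
- by move=> q hq; rewrite -e//; exact: fb.
- exists h; split=> // q hq; first by rewrite -e// hf.
  by rewrite -e ?fh//; exact: hb.
- move=> q u v hq; rewrite -e// -(fg q u v hq).
  have n : \forall p \near q, f p = g p by apply: filterS (qball_near hq); exact: e.
  by rewrite !(near_eq_derive _ n).
Qed.

End ActIsometry.

(** * Derivatives of real functions of one variable *)

Section Derive1.
Variable R : realType.

Lemma is_derive1_mul (f g : R -> R) (t a b : R) :
  is_derive t 1 f a -> is_derive t 1 g b ->
  is_derive t 1 (fun s => f s * g s) (f t * b + g t * a).
Proof. by move=> fd gd; exact: (is_deriveM fd gd). Qed.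

Lemma is_derive1_add (f g : R -> R) (t a b : R) :
  is_derive t 1 f a -> is_derive t 1 g b ->
  is_derive t 1 (fun s => f s + g s) (a + b).
Proof. by move=> fd gd; exact: (is_deriveD fd gd). Qed.

Lemma is_derive1_opp (f : R -> R) (t a : R) :
  is_derive t 1 f a -> is_derive t 1 (fun s => - f s) (- a).
Proof. by move=> fd; exact: (is_deriveN fd). Qed.

Lemma is_derive1_inv (f : R -> R) (t a : R) : f t != 0 ->
  is_derive t 1 f a -> is_derive t 1 (fun s => (f s)^-1) (- a / f t ^+ 2).
Proof.
move=> f0 [fd <-]; apply: DeriveDef; first exact: derivableV.
by rewrite deriveV// -exprVn /GRing.scale /= mulNr mulrC mulNr.
Qed.

End Derive1.

(** * The slice metric in coordinates and its radial part *)

Section SliceMetric.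
Variable R : realType.
Implicit Types (p q r u v : quat R) (a k s t e x : R).

Definition slice_q q v : R := slice_g q v v.

(* cross2 q v = |Im q x Im v|^2, that is, |Im q|^2 times the squared norm of the
   component of v that anticommutes with Im q. *)
Definition cross2 q v : R :=
  (q2 q * q3 v - q3 q * q2 v) ^+ 2 + (q3 q * q1 v - q1 q * q3 v) ^+ 2
  + (q1 q * q2 v - q2 q * q1 v) ^+ 2.

(* The inner product of Im q with Re q Im v - Re v Im q; it appears as the
   remainder in Lagrange's identity. *)
Definition im_dot q v : R :=
  q1 q * (q0 q * q1 v - q0 v * q1 q) + q2 q * (q0 q * q2 v - q0 v * q2 q)
  + q3 q * (q0 q * q3 v - q0 v * q3 q).

(** The map v |-> v - q v q scales the part of v commuting with q by |1 - q^2| and the part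
    anticommuting with Im q by 1 - |q|^2; the squares of these factors differ by 4 |Im q|^2. *)
Lemma qslice_norm q v : qnorm2 (qslice q v) = qden q * qnorm2 v - 4 * cross2 q v.
Proof. by rewrite qdenE /cross2 /qslice /qnorm2; qexpand; ring. Qed.

Lemma slice_qE q v :
  slice_q q v = (qden q * qnorm2 v - 4 * cross2 q v) / (qden q * (1 - qnorm2 q) ^+ 2).
Proof. by rewrite /slice_q slice_gE qdotpp qslice_norm. Qed.

(* Radial part plus a nonnegative tangential part: the Gauss lemma at 0. *)
Lemma slice_q_radial q v : qball q ->
  slice_q q v * (qden q * (1 - qnorm2 q) ^+ 2 * qnorm2 q) =
  qden q * qdot q v ^+ 2
  + (1 - qnorm2 q) ^+ 2 * (qnorm2 q * qnorm2 v - qdot q v ^+ 2)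
  + 4 * im_dot q v ^+ 2.
Proof.
move=> hq; have d0 := qden_gt0 hq.
have n0 : 1 - qnorm2 q != 0 by rewrite gt_eqF// subr_gt0.
have -> : slice_q q v * (qden q * (1 - qnorm2 q) ^+ 2 * qnorm2 q) =
    (qden q * qnorm2 v - 4 * cross2 q v) * qnorm2 q.
  by rewrite slice_qE; field; rewrite n0 gt_eqF.
by rewrite qdenE /cross2 /im_dot /qdot /qnorm2; ring.
Qed.

Lemma cauchy_schwarz q v : 0 <= qnorm2 q * qnorm2 v - qdot q v ^+ 2.
Proof.
rewrite (_ : _ - _ = cross2 q v + (q0 q * q1 v - q0 v * q1 q) ^+ 2
  + (q0 q * q2 v - q0 v * q2 q) ^+ 2 + (q0 q * q3 v - q0 v * q3 q) ^+ 2).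
  by rewrite /cross2 !addr_ge0// sqr_ge0.
by rewrite /cross2 /qdot /qnorm2; ring.
Qed.

Lemma slice_q_ge_radial q v : qball q ->
  qdot q v ^+ 2 <= slice_q q v * ((1 - qnorm2 q) ^+ 2 * qnorm2 q).
Proof.
move=> hq; have d0 := qden_gt0 hq; rewrite -(ler_pM2l d0).
rewrite [leRHS](_ : _ = slice_q q v * (qden q * (1 - qnorm2 q) ^+ 2 * qnorm2 q)).
  rewrite slice_q_radial// -addrA lerDl addr_ge0//.
    by rewrite mulr_ge0 ?sqr_ge0 ?cauchy_schwarz.
  by rewrite mulr_ge0 ?sqr_ge0.
by ring.
Qed.

(** Equality in the Gauss lemma makes both nonnegative remainders vanish; the first one is the
    defect in Cauchy-Schwarz, so v is parallel to q. *)
Lemma slice_q_eq_radial q v : qball q -> q != 0 ->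
  slice_q q v * ((1 - qnorm2 q) ^+ 2 * qnorm2 q) = qdot q v ^+ 2 ->
  v = (qdot q v / qnorm2 q) *: q.
Proof.
move=> hq q_neq0 E; have N0 := qnorm2_gt0 q_neq0.
have n0 : 0 < (1 - qnorm2 q) ^+ 2 by rewrite exprn_gt0// subr_gt0.
have : (1 - qnorm2 q) ^+ 2 * (qnorm2 q * qnorm2 v - qdot q v ^+ 2) = 0.
  have := slice_q_radial v hq.
  rewrite (_ : slice_q q v * _ = qden q * (slice_q q v * ((1 - qnorm2 q) ^+ 2 * qnorm2 q)));
    last by ring.
  rewrite E; have := cauchy_schwarz q v; have := sqr_ge0 (im_dot q v).
  by move: (_ - qdot q v ^+ 2) => c; set m := (_ ^+ 2) in n0 *; nra.
move=> /eqP; rewrite mulf_eq0 gt_eqF//= => /eqP cs.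
apply/eqP; rewrite -subr_eq0; apply/eqP/qnorm2_eq0.
have -> : qnorm2 (v - (qdot q v / qnorm2 q) *: q) =
    (qnorm2 q * qnorm2 v - qdot q v ^+ 2) / qnorm2 q.
  have -> : qnorm2 (v - (qdot q v / qnorm2 q) *: q) =
      qnorm2 v - 2 * (qdot q v / qnorm2 q) * qdot q v
      + (qdot q v / qnorm2 q) ^+ 2 * qnorm2 q.
    by move: (qdot q v / qnorm2 q) => l; rewrite /qdot /qnorm2 ?qcoordE; ring.
  by field; rewrite gt_eqF.
by rewrite cs mul0r.
Qed.

Definition atanh x : R := (ln (1 + x) - ln (1 - x)) / 2.

Lemma tanhK : cancel (@tanh R) atanh.
Proof.
move=> t; have := tanh_sqr_lt1 t; rewrite tanh_expR /atanh.
have x0 := expR_gt0 t; set x := expR t in x0 *; move=> _.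
have hx : 0 < x ^+ 2 + 1 by rewrite ltr_wpDl// sqr_ge0.
have -> : 1 + (x ^+ 2 - 1) / (x ^+ 2 + 1) = x ^+ 2 * (2 / (x ^+ 2 + 1)).
  by field; rewrite gt_eqF.
have -> : 1 - (x ^+ 2 - 1) / (x ^+ 2 + 1) = 2 / (x ^+ 2 + 1).
  by field; rewrite gt_eqF.
rewrite lnM ?posrE ?exprn_gt0 ?divr_gt0// addrK lnXn// /x expRK.
by rewrite -[t *+ 2]mulr_natr mulfK.
Qed.

Lemma atanhK x : x ^+ 2 < 1 -> tanh (atanh x) = x.
Proof. by move=> /tanh_surj[t <-]; rewrite tanhK. Qed.

Lemma is_derive1_addl (c x : R) : is_derive x 1 (fun y : R => c + y) 1.
Proof.
rewrite (_ : (fun y => c + y) = cst c + id)//.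
by apply: is_derive_eq; rewrite add0r.
Qed.

Lemma is_derive1_subl (c x : R) : is_derive x 1 (fun y : R => c - y) (-1).
Proof.
rewrite (_ : (fun y => c - y) = cst c - id)//.
by apply: is_derive_eq; rewrite sub0r.
Qed.

Lemma is_derive_atanh x : x ^+ 2 < 1 -> is_derive x 1 atanh (1 - x ^+ 2)^-1.
Proof.
move=> hx; have xm : 0 < 1 - x by nra.
have xp : 0 < 1 + x by nra.
have dp : is_derive x 1 (fun y : R => ln (1 + y)) ((1 + x)^-1 * 1).
  apply: (@is_derive1_comp _ _ (fun y : R => 1 + y)); first exact: is_derive1_ln.
  exact: is_derive1_addl.
have dm : is_derive x 1 (fun y : R => ln (1 - y)) ((1 - x)^-1 * -1).
  apply: (@is_derive1_comp _ _ (fun y : R => 1 - y)); first exact: is_derive1_ln.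
  exact: is_derive1_subl.
have -> : atanh = (2^-1 : R) \*: ((fun y : R => ln (1 + y)) - (fun y : R => ln (1 - y))).
  by apply/funext => y; rewrite /atanh mulrC.
apply: is_derive_eq; rewrite /GRing.scale /=; field.
by rewrite !gt_eqF// subr_gt0.
Qed.

Lemma is_derive_tanh t : is_derive t 1 (@tanh R) (1 - tanh t ^+ 2).
Proof.
have den0 (s : R) : expR s + expR (- s) != 0 by rewrite gt_eqF// addr_gt0// expR_gt0.
have dE := is_derive_expR t.
have dN : is_derive t 1 (fun s : R => expR (- s)) (expR (- t) * -1).
  by apply: (@is_derive1_comp _ _ (fun y : R => - y)); exact: is_deriveNid.
have dnum := is_derive1_add dE (is_derive1_opp dN).
have dinv := @is_derive1_inv _ (fun s => expR s + expR (- s)) t _ (den0 t)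
  (is_derive1_add dE dN).
apply: (is_derive_eq (is_derive1_mul dnum dinv)).
by rewrite /tanh; field; exact: den0.
Qed.

End SliceMetric.

(** * Distance to the origin along curves *)

Section Curves.
Variable R : realType.
Implicit Types (q v w : quat R) (c : R -> quat R).

Lemma is_derive1_coord c (t : R) v i :
  is_derive t 1 c v -> is_derive t 1 (fun s => c s ord0 i) (v ord0 i).
Proof.
move=> [cd cE]; apply: DeriveDef; first by move/derivable_mxP : cd; exact.
by move: cE; rewrite derive_mx// => <-; rewrite mxE.
Qed.

Lemma is_derive1_qnorm2 c (t : R) v : is_derive t 1 c v ->
  is_derive t 1 (fun s => qnorm2 (c s)) (2 * qdot (c t) v).
Proof.
move=> cd; have sq i : is_derive t 1 (fun s => c s ord0 i * c s ord0 i)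
    (2 * (c t ord0 i * v ord0 i)).
  have ci := is_derive1_coord i cd.
  by have := is_derive1_mul ci ci; rewrite -mulr2n mulr_natl.
rewrite (_ : (fun s => _) = fun s => q0 (c s) * q0 (c s) + q1 (c s) * q1 (c s)
    + q2 (c s) * q2 (c s) + q3 (c s) * q3 (c s)); last first.
  by apply/funext => s; rewrite /qnorm2 !expr2.
rewrite /qdot !mulrDr; do 3! apply: is_derive1_add; exact: sq.
Qed.

Lemma tanh_ge0 (s : R) : 0 <= s -> 0 <= tanh s.
Proof.
move=> s0; have h : 1 <= expR s by rewrite -expR0 ler_expR.
rewrite tanh_expR divr_ge0//.
by rewrite subr_ge0 exprn_ege1.
Qed.

(* The slice distance from 0 to q: radial segments are minimizing. *)
Definition hdist q : R := atanh (Num.sqrt (qnorm2 q)).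

Lemma hdist_tanh (s : R) w : qnorm2 w = 1 -> hdist (tanh s *: w) = `|s|.
Proof.
move=> w1; rewrite /hdist qnorm2Z w1 mulr1 sqrtr_sqr.
wlog s0 : s / 0 <= s => [H|].
  have [/H//|s0] := leP 0 s.
  by rewrite -normrN -tanhN -[RHS]normrN; apply: H; rewrite oppr_ge0 ltW.
by rewrite ger0_norm ?tanh_ge0// tanhK ger0_norm.
Qed.

Lemma hdist0 : hdist 0 = 0.
Proof. by have := @tanhK R 0; rewrite /hdist qnorm2_0 sqrtr0 tanh0. Qed.

Lemma sqrt_qnorm2_lt1 q : qball q -> Num.sqrt (qnorm2 q) ^+ 2 < 1.
Proof. by move=> hq; rewrite sqr_sqrtr ?qnorm2_ge0. Qed.

Lemma hdist_inj q v : qball q -> qball v -> hdist q = hdist v ->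
  qnorm2 q = qnorm2 v.
Proof.
move=> hq hv /(congr1 (@tanh R)); rewrite /hdist !atanhK ?sqrt_qnorm2_lt1//.
by move=> /(congr1 (fun x => x ^+ 2)); rewrite !sqr_sqrtr ?qnorm2_ge0.
Qed.

Lemma continuous_hdist_curve c (t : R) : qball (c t) ->
  {for t, continuous c} -> {for t, continuous (fun s => hdist (c s))}.
Proof.
move=> ht ct.
have cn : {for t, continuous (fun s => qnorm2 (c s))}.
  have nc : {for c t, continuous (@qnorm2 R)}.
    exact: Cn_cont (Cn_norm (@smooth_coord_id R) 0%N) ht.
  exact: continuous_comp ct nc.
have cs : {for t, continuous (fun s => Num.sqrt (qnorm2 (c s)))}.
  exact: continuous_comp cn (@sqrt_continuous R _).
have ca : {for Num.sqrt (qnorm2 (c t)), continuous (@atanh R)}.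
  apply/differentiable_continuous/derivable1_diffP.
  by have [] := is_derive_atanh (sqrt_qnorm2_lt1 ht).
exact: continuous_comp cs ca.
Qed.

Lemma is_derive1_hdist c (t : R) v : qball (c t) -> c t != 0 ->
  is_derive t 1 c v -> is_derive t 1 (fun s => hdist (c s))
    (qdot (c t) v / (Num.sqrt (qnorm2 (c t)) * (1 - qnorm2 (c t)))).
Proof.
move=> ht c0 cd; have N0 := qnorm2_gt0 c0.
have d1 := is_derive1_qnorm2 cd; have d2 := is_derive1_sqrt N0.
have d3 := is_derive_atanh (sqrt_qnorm2_lt1 ht).
have d12 := @is_derive1_comp _ _ (fun s => qnorm2 (c s)) t _ _ d2 d1.
have := @is_derive1_comp _ _ (fun s => Num.sqrt (qnorm2 (c s))) t _ _ d3 d12.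
move/is_derive_eq; apply; rewrite sqr_sqrtr ?qnorm2_ge0//.
have x0 : 0 < Num.sqrt (qnorm2 (c t)) by rewrite sqrtr_gt0.
by field; rewrite [_ - _ == 0]gt_eqF ?subr_gt0//= gt_eqF.
Qed.

(** By the Gauss lemma the derivative of [hdist] along c is at most the speed; the mean value
    theorem concludes. The curve may meet 0 at its ends only, because [hdist] is continuous but not
    differentiable there. *)
Lemma hdist_growth c (a b V : R) : a <= b -> 0 <= V ->
  (forall t, a <= t <= b -> qball (c t) /\ {for t, continuous c}) ->
  (forall t, a < t < b -> c t != 0 /\
     exists v, is_derive t 1 c v /\ slice_q (c t) v <= V ^+ 2) ->
  hdist (c b) - hdist (c a) <= V * (b - a).
Proof.
rewrite le_eqVlt => /predU1P[<-|ab] V0 cb cd; first by rewrite !subrr mulr0.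
pose phi t := hdist (c t).
have D t : a < t < b -> exists2 d, is_derive t 1 phi d & d <= V.
  move=> tab; have [ct0 [v [dv gv]]] := cd t tab.
  have /cb[ht _] : a <= t <= b by case/andP: tab => *; rewrite !ltW.
  exists (qdot (c t) v / (Num.sqrt (qnorm2 (c t)) * (1 - qnorm2 (c t)))).
    exact: is_derive1_hdist.
  have x0 : 0 < Num.sqrt (qnorm2 (c t)) by rewrite sqrtr_gt0 qnorm2_gt0.
  have m0 : 0 < 1 - qnorm2 (c t) by rewrite subr_gt0.
  rewrite ler_pdivrMr ?mulr_gt0//.
  have [|q0] := leP (qdot (c t) v) 0.
    by move=> /le_trans; apply; rewrite !mulr_ge0// ltW.
  rewrite -ler_sqr ?nnegrE; [|exact: ltW|by rewrite !mulr_ge0// ltW].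
  apply: le_trans (slice_q_ge_radial v ht) _.
  rewrite !exprMn sqr_sqrtr ?qnorm2_ge0// (mulrC (qnorm2 (c t))).
  by apply: ler_wpM2r => //; rewrite mulr_ge0 ?sqr_ge0 ?qnorm2_ge0.
have [| |x xab ->] := MVT ab (f := phi) (df := 'D_1 phi).
- move=> x; rewrite in_itv /= => xab.
  have [d [d1 _] _] := D x xab; exact: DeriveDef.
- apply: continuous_in_subspaceT => x; rewrite inE /= in_itv /= => /cb[h1 h2].
  exact: continuous_hdist_curve.
- move: xab; rewrite in_itv /= => /D[d [_ ->] dV].
  by rewrite ler_wpM2r// subr_ge0 ltW.
Qed.

End Curves.

(** * Chain rules for maps and curves *)

Section Calculus.
Variable R : realType.

Lemma is_derive_comp (U V W : normedModType R) (f : V -> W) (g : U -> V) (x u : U) (v : V) :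
  differentiable g x -> differentiable f (g x) -> is_derive x u g v ->
  is_derive x u (f \o g) ('D_v f (g x)).
Proof.
move=> dg df [_ <-]; apply: DeriveDef; first exact/diff_derivable/differentiable_comp.
by rewrite (deriveE _ (differentiable_comp dg df)) diff_comp// (deriveE _ df) (deriveE _ dg).
Qed.

Lemma is_derive1_curve (V W : normedModType R) (f : V -> W) (c : R -> V) (t : R) (v : V) :
  differentiable f (c t) -> is_derive t 1 c v ->
  is_derive t 1 (fun s => f (c s)) ('D_v f (c t)).
Proof.
move=> df cd; apply: is_derive_comp => //; apply/derivable1_diffP.
by have [] := cd.
Qed.

Lemma is_derive1_scale (W : normedModType R) (k : R -> R) (w : W) (t a : R) :
  is_derive t 1 k a -> is_derive t 1 (fun s => k s *: w) (a *: w).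
Proof.
move=> [kd <-]; have dk : differentiable k t by exact/derivable1_diffP.
apply: DeriveDef; first exact/derivable1_diffP/differentiableZl.
by rewrite (deriveE _ (differentiableZl w dk)) diffZl// (deriveE _ dk).
Qed.

Lemma is_derive1_continuous (W : normedModType R) (c : R -> W) (t : R) (v : W) :
  is_derive t 1 c v -> {for t, continuous c}.
Proof. by move=> [cd _]; apply/differentiable_continuous/derivable1_diffP. Qed.

(** The derivative exists, so its value can be read off the one-sided difference quotient, which is
    constant. *)
Lemma derive_right_cst (V W : normedModType R) (f : V -> W) (x v : V) (w : W) :
  derivable f x v -> (forall t : R, 0 < t < 1 -> f (t *: v + x) = f x + t *: w) ->
  'D_v f x = w.
Proof.
move=> fd fw.
have c : h^-1 *: (f (h *: v + x) - f x) @[h --> (0 : R)^'+] --> 'D_v f x.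
  exact: (@cvg_dnbhs_at_right R W (fun h => h^-1 *: (f (h *: v + x) - f x)) 0 ('D_v f x) fd).
suff c' : h^-1 *: (f (h *: v + x) - f x) @[h --> (0 : R)^'+] --> w.
  exact: (cvg_unique _ c c').
have cc : (fun=> w) h @[h --> (0 : R)^'+] --> w by exact: cvg_cst.
apply: cvg_trans cc; apply: near_eq_cvg; near=> h.
have h0 : 0 < h by [].
rewrite fw; last by rewrite h0/=; near: h; exact: nbhs_right_lt.
by rewrite addrC addKr scalerA mulVf ?scale1r// gt_eqF.
Unshelve. all: by end_near. Qed.

End Calculus.

(** * Isometries, and those fixing the origin *)

Section RiemannianIsometries.
Variable R : realType.
Implicit Types (p q v w : quat R) (f h : quat R -> quat R).

(** Carries the inverse as data, which makes the notion symmetric and closed under composition. The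
    metric enters through its quadratic form, which determines g by polarization. *)
Record risom f h : Prop := Risom {
  risom_diff : forall q, qball q -> differentiable f q;
  risom_diffV : forall q, qball q -> differentiable h q;
  risom_ball : forall q, qball q -> qball (f q);
  risom_ballV : forall q, qball q -> qball (h q);
  risomK : forall q, qball q -> h (f q) = q;
  risomVK : forall q, qball q -> f (h q) = q;
  risom_metric : forall q v, qball q -> slice_q (f q) ('D_v f q) = slice_q q v }.

Lemma risom_derivable f h q v : risom f h -> qball q -> is_derive q v f ('D_v f q).
Proof. by move=> rf hq; apply: DeriveDef => //; exact/diff_derivable/(risom_diff rf). Qed.

(** Differentiating f o h = id shows that the derivative of h is a right inverse of that of f; the
    metric condition for f then gives the one for h. *)
Lemma risom_sym f h : risom f h -> risom h f.
Proof.
move=> [df dh fb hb hf fh g]; split=> // q v hq.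
rewrite -[in LHS](g (h q))//; last exact: hb.
rewrite fh//; congr slice_q.
have dhq : is_derive q v h ('D_v h q).
  by apply: DeriveDef => //; exact/diff_derivable/dh.
have [_ <-] := is_derive_comp (dh q hq) (df _ (hb q hq)) dhq.
rewrite -[RHS](@derive_id _ _ q v); apply: near_eq_derive.
by apply: filterS (qball_near hq) => p hp; exact: fh.
Qed.

Lemma risom_comp f h f' h' : risom f h -> risom f' h' -> risom (f \o f') (h' \o h).
Proof.
move=> rf rf'; split=> [q hq|q hq|q hq|q hq|q hq|q hq|q v hq] /=.
- apply: differentiable_comp; first exact: risom_diff rf' _ hq.
  exact/(risom_diff rf)/(risom_ball rf').
- apply: differentiable_comp; first exact: risom_diffV rf _ hq.
  exact/(risom_diffV rf')/(risom_ballV rf).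
- exact/(risom_ball rf)/(risom_ball rf').
- exact/(risom_ballV rf')/(risom_ballV rf).
- by rewrite (risomK rf) ?(risomK rf')//; exact: risom_ball rf' _ hq.
- by rewrite (risomVK rf') ?(risomVK rf)//; exact: risom_ballV rf _ hq.
- have hq' := risom_ball rf' hq.
  have [_ ->] := is_derive_comp (risom_diff rf' hq) (risom_diff rf hq')
    (risom_derivable v rf' hq).
  by rewrite (risom_metric rf)// (risom_metric rf').
Qed.

Lemma slice_isometry_risom f : slice_isometry f -> exists h, risom f h.
Proof.
move=> [sf fb [h [sh hb hf fh]] fg]; exists h; split=> // q.
- exact: smooth_on_differentiable.
- exact: smooth_on_differentiable.
- by move=> v hq; exact: fg.
Qed.

Lemma act_risom (x : grp R) : in_grp x -> risom (act x) (act (grp_inv x)).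
Proof.
move=> hx; have hi := grp_inv_in hx; split=> q.
- by apply: smooth_on_differentiable; exact/smooth_coord_on/act_smooth.
- by apply: smooth_on_differentiable; exact/smooth_coord_on/act_smooth.
- exact: act_ball.
- exact: act_ball.
- exact: act_invl.
- exact: act_invr.
- move=> v hq; have [_ ->] := is_derive_act v hx hq.
  exact: slice_g_act.
Qed.

(** Parallel vectors have no anticommuting part, so along a diameter the metric is the hyperbolic
    one. *)
Lemma slice_q_colinear (a b : R) w : qball (a *: w) ->
  slice_q (a *: w) (b *: w) = b ^+ 2 * qnorm2 w / (1 - a ^+ 2 * qnorm2 w) ^+ 2.
Proof.
move=> hw; have d0 := qden_gt0 hw.
have n0 : 0 < 1 - a ^+ 2 * qnorm2 w by rewrite -qnorm2Z subr_gt0.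
rewrite slice_qE (_ : cross2 _ _ = 0); last by rewrite /cross2 !qcoordE; ring.
by rewrite !qnorm2Z; field; rewrite !gt_eqF.
Qed.

Lemma polar q : qball q -> exists s w, [/\ 0 <= s, qnorm2 w = 1 & q = tanh s *: w].
Proof.
move=> hq; have [->|q_neq0] := eqVneq q 0.
  by exists 0, (qreal 1); rewrite tanh0 scale0r qnorm2_real expr1n.
have N0 := qnorm2_gt0 q_neq0; set x := Num.sqrt (qnorm2 q).
have x0 : 0 < x by rewrite sqrtr_gt0.
have xN : x ^+ 2 = qnorm2 q by rewrite sqr_sqrtr// ltW.
have [s sx] := tanh_surj (sqrt_qnorm2_lt1 hq).
exists s, (x^-1 *: q); split.
- by rewrite leNgt; apply/negP => s0; have := @tanh_ge0 R (- s);
    rewrite tanhN sx oppr_ge0 ltW// => /(_ isT); rewrite oppr_ge0 leNgt x0.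
- by rewrite qnorm2Z -xN exprVn mulVf// expf_neq0// gt_eqF.
- by rewrite sx scalerA mulfV ?scale1r// gt_eqF.
Qed.

Lemma unit_tanh_ball (s : R) w : qnorm2 w = 1 -> qball (tanh s *: w).
Proof. by move=> w1; rewrite /qball /= qnorm2Z w1 mulr1; exact: tanh_sqr_lt1. Qed.

Lemma risom_inj f h p q : risom f h -> qball p -> qball q -> f p = f q -> p = q.
Proof. by move=> rf hp hq e; rewrite -(risomK rf hp) e (risomK rf hq). Qed.

(** The derivative 1 - tanh^2 cancels the hyperbolic factor: diameters parametrized by tanh have
    unit speed, and so do their images. *)
Lemma is_derive_ray f h w (s : R) : risom f h -> qnorm2 w = 1 ->
  exists2 v, is_derive s 1 (fun t => f (tanh t *: w)) v &
    slice_q (f (tanh s *: w)) v = 1.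
Proof.
move=> rf w1; have hs := unit_tanh_ball s w1.
have ds := is_derive1_scale w (is_derive_tanh s).
exists ('D_((1 - tanh s ^+ 2) *: w) f (tanh s *: w)).
  exact: (is_derive1_curve (risom_diff rf hs) ds).
rewrite (risom_metric rf)// slice_q_colinear// w1 !mulr1 mulfV// expf_neq0//.
by rewrite gt_eqF// subr_gt0 tanh_sqr_lt1.
Qed.

Lemma risom_hdist_le f h q : risom f h -> f 0 = 0 -> qball q ->
  hdist (f q) <= hdist q.
Proof.
move=> rf f0 hq; have [s [w [s0 w1 ->]]] := polar hq.
rewrite hdist_tanh// ger0_norm//.
have := @hdist_growth R (fun t => f (tanh t *: w)) 0 s 1 s0 ler01.
rewrite tanh0 scale0r f0 hdist0 !subr0 mul1r; apply.
  move=> t _; split; first exact/(risom_ball rf)/unit_tanh_ball.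
  have [v dv _] := is_derive_ray t rf w1; exact: is_derive1_continuous dv.
move=> t /andP[t0 _]; split.
  (* Injectivity keeps the image of the ray away from 0 at positive times. *)
  apply: contraTneq t0 => ft0; rewrite -leNgt.
  have : tanh t *: w = 0.
    by apply: (risom_inj rf); [exact: unit_tanh_ball | exact: qball0 | rewrite f0].
  move=> /(congr1 (@hdist R)); rewrite hdist_tanh// hdist0 => /eqP.
  by rewrite normr_eq0 => /eqP ->.
by have [v dv gv] := is_derive_ray t rf w1; exists v; rewrite gv expr1n.
Qed.

Lemma risom_qnorm2 f h q : risom f h -> f 0 = 0 -> qball q ->
  qnorm2 (f q) = qnorm2 q.
Proof.
move=> rf f0 hq; have hfq := risom_ball rf hq.
apply: hdist_inj => //; apply/eqP; rewrite eq_le (risom_hdist_le rf)//=.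
have h0 : h 0 = 0 by rewrite -{1}f0 (risomK rf)//; exact: qball0.
have := risom_hdist_le (risom_sym rf) h0 hfq.
by rewrite (risomK rf).
Qed.

Lemma qball_scale (t : R) q : 0 <= t <= 1 -> qball q -> qball (t *: q).
Proof.
rewrite /qball /= qnorm2Z => /andP[t0 t1]; apply: le_lt_trans.
by rewrite ler_piMl ?qnorm2_ge0// exprn_ile1.
Qed.

(** Preservation of |q| fixes the radial component of the derivative, preservation of g its length.
    Together they give equality in the Gauss lemma at f (t q), so the derivative is radial there. *)
Lemma risom_radial_derive f h (t : R) q : risom f h -> f 0 = 0 -> qball q ->
  q != 0 -> 0 < t < 1 ->
  is_derive t 1 (fun s => f (s *: q)) (t^-1 *: f (t *: q)).
Proof.
move=> rf f0 hq q0 /andP[t0 t1].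
have N0 := qnorm2_gt0 q0.
have htq : qball (t *: q) by apply: qball_scale => //; rewrite !ltW.
have dl : is_derive t 1 (fun s : R => s *: q) q.
  by have := is_derive1_scale q (is_derive_id t 1); rewrite scale1r.
have dv := is_derive1_curve (risom_diff rf htq) dl.
set v := 'D_q f (t *: q) in dv.
suff <- : v = t^-1 *: f (t *: q) by [].
have dot : qdot (f (t *: q)) v = t * qnorm2 q.
  have d1 := is_derive1_qnorm2 dv.
  have d2 : is_derive t 1 (fun s => qnorm2 (f (s *: q))) (2 * qdot (t *: q) q).
    apply: near_eq_is_derive (is_derive1_qnorm2 dl).
    have ct := is_derive1_continuous dl.
    have nt : \forall s \near t, qball (s *: q) by exact: ct _ (qball_near htq).
    by apply: filterS nt => s hs; rewrite (risom_qnorm2 rf).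
  have : 2 * qdot (f (t *: q)) v = 2 * qdot (t *: q) q.
    by have [_ <-] := d1; have [_ <-] := d2.
  rewrite (_ : qdot (t *: q) q = t * qnorm2 q).
    by move=> ?; lra.
  by rewrite /qdot /qnorm2 !qcoordE; ring.
have nf : qnorm2 (f (t *: q)) = t ^+ 2 * qnorm2 q by rewrite (risom_qnorm2 rf)// qnorm2Z.
rewrite (slice_q_eq_radial (risom_ball rf htq) (v := v)).
- rewrite dot nf; congr (_ *: _); field; rewrite !gt_eqF//.
- by apply: contra_eq_neq nf => ->; rewrite qnorm2_0 lt_eqF// mulr_gt0// exprn_gt0.
- rewrite dot nf (risom_metric rf)// -{2}[q]scale1r slice_q_colinear//.
  field; rewrite gt_eqF// subr_gt0 -qnorm2Z; exact: htq.
Qed.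

Lemma risom_radial f h (t : R) q : risom f h -> f 0 = 0 -> qball q ->
  0 < t < 1 -> f (t *: q) = t *: f q.
Proof.
move=> rf f0 hq /andP[t0 t1].
have [->|q0] := eqVneq q 0; first by rewrite scaler0 f0 scaler0.
suff E : forall i, (t *: f q) ord0 i = f (t *: q) ord0 i by apply/esym/rowP.
(* The radial equation says that f (s q) / s has derivative zero; comparing s = t with s = 1 stays
   away from the singularity at s = 0. *)
move=> i; pose g := fun s : R => s^-1 * f (s *: q) ord0 i.
have dg (s : R) : 0 < s < 1 -> is_derive s (1 : R) g 0.
  move=> s01; have /andP[s0 s1] := s01.
  have d1 := is_derive1_coord i (risom_radial_derive rf f0 hq q0 s01).
  have s_neq0 : id s != 0 by rewrite gt_eqF.
  have d2 := is_derive1_inv s_neq0 (is_derive_id s 1).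
  apply: (is_derive_eq (is_derive1_mul d2 d1)); rewrite mxE /=; field.
  by rewrite gt_eqF.
have cg (s : R) : 0 < s <= 1 -> {for s, continuous g}.
  move=> /andP[s0 s1].
  have hs : qball (s *: q) by apply: qball_scale => //; rewrite (ltW s0).
  have dl : is_derive s 1 (fun s : R => s *: q) q.
    by have := is_derive1_scale q (is_derive_id s 1); rewrite scale1r.
  have d1 := is_derive1_coord i (is_derive1_curve (risom_diff rf hs) dl).
  have s_neq0 : id s != 0 by rewrite gt_eqF.
  have d2 := is_derive1_inv s_neq0 (is_derive_id s 1).
  exact: is_derive1_continuous (is_derive1_mul d2 d1).
have [| |x xt] := MVT t1 (f := g) (df := fun=> 0).
- move=> x; rewrite in_itv /= => /andP[tx x1]; apply: dg.
  by rewrite (lt_trans t0 tx).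
- apply: continuous_in_subspaceT => x; rewrite inE /= in_itv /= => /andP[tx x1].
  by apply: cg; rewrite (lt_le_trans t0 tx).
- rewrite mul0r => /eqP; rewrite subr_eq0 => /eqP; rewrite /g invr1 mul1r scale1r.
  by rewrite mxE => ->; rewrite mulrA mulfV ?mul1r// gt_eqF.
Qed.

(* An isometry fixing the origin is the restriction of a linear map, since it
   maps rays to rays. *)
Lemma risom0_linear f h q : risom f h -> f 0 = 0 -> qball q ->
  f q = 'd f 0 q.
Proof.
move=> rf f0 hq; have d0 := risom_diff rf (@qball0 R).
rewrite -deriveE//.
apply/esym/derive_right_cst; first exact: diff_derivable.
by move=> t t01; rewrite addr0 (risom_radial rf)// f0 add0r.
Qed.

End RiemannianIsometries.

(** * Orthogonal maps and the stabilizer of the origin *)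

Section LinearIsometries.
Variable R : realType.
Implicit Types (p q u v w x : quat R) (f h F G : quat R -> quat R) (a e k : R).

Local Notation "p ** q" := (qmul p q) (at level 40, left associativity).

Definition qi : quat R := mkQ 0 1 0 0.
Definition qj : quat R := mkQ 0 0 1 0.
Definition qk : quat R := mkQ 0 0 0 1.

Record orth F : Prop := Orth {
  orthD : forall p q, F (p + q) = F p + F q;
  orthZ : forall k q, F (k *: q) = k *: F q;
  orth_norm : forall q, qnorm2 (F q) = qnorm2 q }.

Lemma quat_basis q :
  q = q0 q *: qreal 1 + q1 q *: qi + q2 q *: qj + q3 q *: qk.
Proof. by rewrite /qi /qj /qk; qring. Qed.

Lemma orth_ext F G : orth F -> orth G -> F (qreal 1) = G (qreal 1) ->
  F qi = G qi -> F qj = G qj -> F qk = G qk -> F =1 G.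
Proof.
move=> oF oG e0 e1 e2 e3 q; rewrite (quat_basis q).
by rewrite !(orthD oF) !(orthZ oF) !(orthD oG) !(orthZ oG) e0 e1 e2 e3.
Qed.

Lemma qnorm2D p q : qnorm2 (p + q) = qnorm2 p + qnorm2 q + 2 * qdot p q.
Proof. by rewrite /qnorm2 /qdot !qcoordE; ring. Qed.

Lemma orth_dot F p q : orth F -> qdot (F p) (F q) = qdot p q.
Proof.
move=> oF; have := orth_norm oF (p + q); rewrite (orthD oF) !qnorm2D !(orth_norm oF).
by move=> ?; lra.
Qed.

Lemma orth_comp F G : orth F -> orth G -> orth (F \o G).
Proof.
move=> oF oG; split=> [p q|k q|q] /=.
- by rewrite (orthD oG) (orthD oF).
- by rewrite (orthZ oG) (orthZ oF).
- by rewrite (orth_norm oF) (orth_norm oG).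
Qed.

Lemma rot_orth u : qnorm2 u = 1 -> orth (rot u).
Proof. by move=> u1; split=> *; rewrite ?rotD ?rotZ ?rot_norm. Qed.

Lemma qconj_orth : orth (@qconj R).
Proof. by split=> *; rewrite ?qconjD ?qconjZ ?qnorm2_conj. Qed.

Lemma id_orth : orth id. Proof. by []. Qed.

Lemma rot_conjK u q : qnorm2 u = 1 -> rot u (rot (qconj u) q) = q.
Proof.
move=> u1; rewrite rotM qmulC_conj u1 /rot qmul1l.
by rewrite (_ : qconj _ = qreal 1) ?qmul1r//; qring.
Qed.

(** For w = 1 - q p both w p and q w equal p + q, so w conjugates p to q; it vanishes only for q = -
    p. The shape of u is exported because [pure_rot_qi] must see what commutes with it. *)
Lemma rot_to p q : p ** p = - qreal 1 -> q ** q = - qreal 1 -> q != - p ->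
  exists2 u, qnorm2 u = 1 &
    rot u p = q /\ exists2 k, u = k *: (qreal 1 - q ** p) & k != 0.
Proof.
move=> pp qq qNp; set w := qreal 1 - q ** p.
have w0 : w != 0.
  apply: contraNneq qNp => /(congr1 (qmul q)).
  rewrite /w qmulBr qmul1r qmulA qq => /eqP.
  rewrite (_ : - qreal 1 ** p = - p); last by qring.
  by rewrite (_ : q ** 0 = 0) ?opprK ?addr_eq0//; qring.
have N0 := qnorm2_gt0 w0; set k := (Num.sqrt (qnorm2 w))^-1.
have kk : k ^+ 2 * qnorm2 w = 1.
  by rewrite exprVn sqr_sqrtr ?ltW// mulVf// gt_eqF.
have k0 : k != 0 by apply/eqP => h; move: kk; rewrite h expr0n mul0r; lra.
exists (k *: w); first by rewrite qnorm2Z.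
split; last by exists k.
have wp : w ** p = q ** w.
  rewrite /w qmulBl qmulBr qmulA qq -qmulA pp.
  by rewrite (_ : - qreal 1 ** p = - p); qring.
rewrite /rot qconjZ !qmulZl !qmulZr wp -qmulA qmulC_conj qmulrr !scalerA.
by rewrite -expr2 kk scale1r.
Qed.

Lemma pure_unit_sqr q : q0 q = 0 -> qnorm2 q = 1 -> q ** q = - qreal 1.
Proof.
rewrite /qnorm2 => z n; apply: quatP; rewrite /qmul /qreal !qcoordE ?z; try ring.
by rewrite -n z; ring.
Qed.

Lemma qnorm2_qi : qnorm2 qi = 1.
Proof. by rewrite /qnorm2 /qi !qcoordE; ring. Qed.
Lemma qnorm2_qj : qnorm2 qj = 1.
Proof. by rewrite /qnorm2 /qj !qcoordE; ring. Qed.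
Lemma qnorm2_qk : qnorm2 qk = 1.
Proof. by rewrite /qnorm2 /qk !qcoordE; ring. Qed.

Lemma pure_rot q : q0 q = 0 -> qnorm2 q = 1 ->
  exists2 u, qnorm2 u = 1 & rot u qi = q.
Proof.
move=> z n; have [->|qN] := eqVneq q (- qi).
  by exists qj; [exact: qnorm2_qj | rewrite /rot /qi /qj; qring].
have ii : qi ** qi = - qreal 1 by rewrite /qi; qring.
by have [u u1 [ru _]] := rot_to ii (pure_unit_sqr z n) qN; exists u.
Qed.

(** Both q and j anticommute with i, so q j commutes with i, and so does the conjugating element 1 -
    q j up to scale. In the exceptional case q = - j, conjugation by i serves. *)
Lemma pure_rot_qi q : q0 q = 0 -> q1 q = 0 -> qnorm2 q = 1 ->
  exists u, [/\ qnorm2 u = 1, rot u qi = qi & rot u qj = q].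
Proof.
move=> z0 z1 n; have [->|qN] := eqVneq q (- qj).
  by exists qi; split; [exact: qnorm2_qi | rewrite /rot /qi; qring
    | rewrite /rot /qi /qj; qring].
have jj : qj ** qj = - qreal 1 by rewrite /qj; qring.
have [u u1 [ru [k uk _]]] := rot_to jj (pure_unit_sqr z0 n) qN.
exists u; split=> //.
have C : u ** qi = qi ** u.
  rewrite uk qmulZl qmulZr; congr (_ *: _).
  by apply: quatP; rewrite /qi /qj /qmul /qreal !qcoordE z0 z1; ring.
by rewrite /rot C -qmulA qmulC_conj u1 qmul1r.
Qed.

Lemma orth_real F q : orth F -> F (qreal 1) = qreal 1 -> q0 (F q) = q0 q.
Proof.
have dot1 p : qdot p (qreal 1) = q0 p by rewrite /qdot /qreal !qcoordE; ring.
by move=> oF F1; rewrite -[LHS]dot1 -F1 orth_dot.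
Qed.

(* Composing with rotations, make F fix 1, i and then j; what is left is the
   sign of F k, and k |-> -k is a rotation of the conjugation. *)
Lemma orth_fix1 F : orth F -> F (qreal 1) = qreal 1 ->
  exists u e, [/\ qnorm2 u = 1, e = 1 \/ e = -1 & forall q, F q = rot u (cj e q)].
Proof.
move=> oF F1.
have [u u1 ui] : exists2 u, qnorm2 u = 1 & rot u qi = F qi.
  apply: pure_rot; first by rewrite orth_real// /qi q0_mkQ.
  by rewrite (orth_norm oF) qnorm2_qi.
have cu1 : qnorm2 (qconj u) = 1 by rewrite qnorm2_conj.
pose G := rot (qconj u) \o F; have oG : orth G by exact/orth_comp/oF/rot_orth.
have G1 : G (qreal 1) = qreal 1 by rewrite /G /= F1 rot_real.
have Gi : G qi = qi by rewrite /G /= -ui -{2}[u]qconjK rot_conjK.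
have doti p : qdot p qi = q1 p by rewrite /qdot /qi !qcoordE; ring.
have dotj p : qdot p qj = q2 p by rewrite /qdot /qj !qcoordE; ring.
have [v [v1 vi vj]] : exists v, [/\ qnorm2 v = 1, rot v qi = qi & rot v qj = G qj].
  apply: pure_rot_qi; first by rewrite orth_real// /qj q0_mkQ.
    by rewrite -doti -{1}Gi orth_dot// doti /qj q1_mkQ.
  by rewrite (orth_norm oG) qnorm2_qj.
have cv1 : qnorm2 (qconj v) = 1 by rewrite qnorm2_conj.
pose H := rot (qconj v) \o G; have oH : orth H by exact/orth_comp/oG/rot_orth.
have H1 : H (qreal 1) = qreal 1 by rewrite /H /= G1 rot_real.
have Hi : H qi = qi by rewrite /H /= Gi -{1}vi -{2}[v]qconjK rot_conjK.
have Hj : H qj = qj by rewrite /H /= -vj -{2}[v]qconjK rot_conjK.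
have FH q : F q = rot (u ** v) (H q) by rewrite /H /= -rotM rot_conjK// rot_conjK.
have uv1 : qnorm2 (u ** v) = 1 by rewrite qnorm2M u1 v1 mulr1.
have Hk0 : q0 (H qk) = 0 by rewrite orth_real// /qk q0_mkQ.
have Hk1 : q1 (H qk) = 0 by rewrite -doti -{1}Hi orth_dot// doti /qk q1_mkQ.
have Hk2 : q2 (H qk) = 0 by rewrite -dotj -{1}Hj orth_dot// dotj /qk q2_mkQ.
have : q3 (H qk) ^+ 2 = 1.
  by have := orth_norm oH qk; rewrite qnorm2_qk /qnorm2 Hk0 Hk1 Hk2 => <-; ring.
move/eqP; rewrite sqrf_eq1 => /orP[] /eqP Hk3.
  exists (u ** v), 1; split=> //; first by left.
  move=> q; rewrite FH /cj eqxx; congr (rot _ _); apply: (orth_ext oH id_orth) => //.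
  by apply: quatP; rewrite ?Hk0 ?Hk1 ?Hk2 ?Hk3 /qk !qcoordE.
exists (u ** v ** qk), (-1); split; first by rewrite qnorm2M uv1 qnorm2_qk mulr1.
  by right.
move=> q; rewrite FH -[rot (u ** v ** qk) _]rotM /cj sign_neq; congr (rot _ _).
apply: (orth_ext oH (orth_comp (rot_orth qnorm2_qk) qconj_orth)) => /=;
  rewrite ?H1 ?Hi ?Hj; rewrite /rot.
- by rewrite /qk; qring.
- by rewrite /qi /qk; qring.
- by rewrite /qj /qk; qring.
apply: quatP; rewrite ?Hk0 ?Hk1 ?Hk2 ?Hk3; rewrite /qk /qmul /qconj !qcoordE; ring.
Qed.

Lemma scale_ball q : exists2 t : R, t != 0 & qball (t *: q).
Proof.
have N0 := qnorm2_ge0 q; have h : 0 < 1 + qnorm2 q by rewrite ltr_wpDr.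
exists (1 + qnorm2 q)^-1; first by rewrite invr_eq0 gt_eqF.
rewrite /qball /= qnorm2Z exprVn mulrC ltr_pdivrMr ?exprn_gt0// mul1r; nra.
Qed.

Lemma risom0_orth f h : risom f h -> f 0 = 0 ->
  exists2 L, orth L & forall q, qball q -> f q = L q.
Proof.
move=> rf f0; exists ('d f 0); last by move=> q hq; exact: risom0_linear rf f0 hq.
have dZ k q : 'd f 0 (k *: q) = k *: 'd f 0 q by exact: linearZ_LR.
split=> [p q|k q|q]; [exact: raddfD | exact: dZ |].
have [t t0 htq] := scale_ball q.
have := risom_qnorm2 rf f0 htq.
rewrite (risom0_linear rf f0 htq) dZ !qnorm2Z => /mulfI; apply.
by rewrite sqrf_eq0.
Qed.

(** At a real point [cross2] vanishes, and there g is a multiple of the Euclidean metric. As the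
    linear map is orthogonal, the same must hold at the image of that point, which forces the image
    to be real. *)
Lemma risom0_act f h : risom f h -> f 0 = 0 -> is_act f.
Proof.
move=> rf f0; have [L oL fL] := risom0_orth rf f0.
have dL q v : qball q -> 'D_v f q = L v.
  move=> hq; pose G : quat R -> quat R := cst (L v).
  have [] := @is_derive_increment R _ _ f G (@qball R) q v; last by move=> _ ->.
  - by move=> t ht; rewrite !fL// (orthD oL) addrK (orthZ oL).
  - exact: qball_near.
  - exact: cst_continuous.
(* Any nonzero real point of the ball would serve. *)
have h2 : qball (2^-1 *: qreal 1 : quat R).
  by rewrite /qball /= qnorm2Z qnorm2_real; lra.
pose z := L (2^-1 *: qreal 1).
have hz : qball z by rewrite /z -fL//; exact: risom_ball rf _ h2.
have C v : cross2 z (L v) = 0.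
  have := risom_metric rf v h2; rewrite dL// fL// -/z.
  have nz : qnorm2 z = qnorm2 (2^-1 *: qreal 1 : quat R) by rewrite /z (orth_norm oL).
  rewrite !slice_qE (orth_norm oL) nz.
  have dz := qden_gt0 hz; have d1 := qden_gt0 h2.
  have m0 : 0 < 1 - qnorm2 (2^-1 *: qreal 1 : quat R) by rewrite subr_gt0.
  rewrite (_ : cross2 (2^-1 *: qreal 1) v = 0); last first.
    by rewrite /cross2 /qreal !qcoordE; ring.
  rewrite mulr0 subr0; set m := 1 - _ in m0 *; set d := qden _ in d1 *.
  move=> /(congr1 (fun y => y * (qden z * m ^+ 2))).
  rewrite mulfVK; last by rewrite mulf_neq0 ?expf_neq0 ?gt_eqF.
  rewrite (_ : _ / _ * _ = qden z * qnorm2 v); first by lra.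
  by field; rewrite !gt_eqF.
have onto w : qball w -> cross2 z w = 0.
  move=> hw; have hhw := risom_ballV rf hw.
  by have := C (h w); rewrite -fL// (risomVK rf).
(* Testing against j / 2 involves the coordinates 1 and 3 of z, testing against k / 2 the
   coordinates 1 and 2. *)
have z1 : q1 z = 0 /\ q2 z = 0 /\ q3 z = 0.
  have hj : qball (2^-1 *: qj) by rewrite /qball /= qnorm2Z qnorm2_qj; lra.
  have hk : qball (2^-1 *: qk) by rewrite /qball /= qnorm2Z qnorm2_qk; lra.
  have := onto _ hj; have := onto _ hk; rewrite /cross2 /qj /qk !qcoordE => E1 E2.
  by split; [|split]; nra.
pose e := q0 (L (qreal 1)).
have zE : z = 2^-1 *: L (qreal 1) by rewrite /z (orthZ oL).
have L1 : L (qreal 1) = qreal e.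
  case: z1 => a1 [a2 a3]; move: a1 a2 a3; rewrite zE !qcoordE => a1 a2 a3.
  by apply: quatP; rewrite [qreal e]/qreal ?qcoordE //; lra.
have e2 : e ^+ 2 = 1.
  by have := orth_norm oL (qreal 1); rewrite L1 !qnorm2_real expr1n.
have e1 : e = 1 \/ e = -1.
  by move/eqP: e2; rewrite sqrf_eq1 => /orP[] /eqP; [left|right].
(* Splitting off the sign leaves a map that fixes 1. *)
pose F q := e *: L q.
have oF : orth F.
  split=> [p q|k q|q]; rewrite /F.
  - by rewrite (orthD oL) scalerDr.
  - by rewrite (orthZ oL) !scalerA mulrC.
  - by rewrite sign_norm// (orth_norm oL).
have F1 : F (qreal 1) = qreal 1.
  by rewrite /F L1 -e2 -qmulrl; qring.
have [u [e' [u1 he' FE]]] := orth_fix1 oF F1.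
exists (u, e, 0, e'); split=> // q hq.
by rewrite actE tanh0 mob0 -FE /F scalerA -expr2 e2 scale1r fL.
Qed.

End LinearIsometries.

(** * Moving a point to the imaginary axis by the group *)

Section Transitivity.
Variable R : realType.
Implicit Types (p q u v w : quat R) (f h : quat R -> quat R) (d s t : R).

Lemma tanh_inj : injective (@tanh R).
Proof. exact: can_inj (@tanhK R). Qed.

Lemma tanh_ge0_inv s : 0 <= tanh s -> 0 <= s.
Proof.
rewrite leNgt => s0; rewrite leNgt; apply/negP => sn; move/negP: s0; apply.
have h : 0 <= tanh (- s) by apply: tanh_ge0; rewrite oppr_ge0 ltW.
rewrite lt_neqAle -oppr_ge0 -tanhN h andbT -tanh0.
by apply/eqP => /tanh_inj E; move: sn; rewrite E ltxx.
Qed.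

Lemma exists_rot_slice p : exists u b,
  [/\ qnorm2 u = 1, 0 <= b & rot u p = mkQ (q0 p) b 0 0].
Proof.
set y := q1 p ^+ 2 + q2 p ^+ 2 + q3 p ^+ 2.
have y0 : 0 <= y by rewrite !addr_ge0// sqr_ge0.
have [yz|yp] := leP y 0.
  exists (qreal 1), 0; split; rewrite ?qnorm2_real ?expr1n//.
  have z : [/\ q1 p = 0, q2 p = 0 & q3 p = 0].
    move: yz; rewrite /y => yz; move: (sqr_ge0 (q1 p)) (sqr_ge0 (q2 p)) (sqr_ge0 (q3 p)).
    by move=> *; split; apply/eqP; rewrite -sqrf_eq0; apply/eqP; lra.
  by case: z => z1 z2 z3; apply: quatP; rewrite /rot /qmul /qconj /qreal !qcoordE
    ?z1 ?z2 ?z3; ring.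
set b := Num.sqrt y; have b0 : 0 < b by rewrite sqrtr_gt0.
have bb : b ^+ 2 = y by rewrite sqr_sqrtr.
pose a := mkQ 0 (q1 p / b) (q2 p / b) (q3 p / b).
have a1 : qnorm2 a = 1.
  rewrite /a /qnorm2 !qcoordE !exprMn exprVn bb expr0n add0r -!mulrDl mulfV//.
  by rewrite gt_eqF.
have [u u1 ua] := pure_rot (q0_mkQ _ _ _ _ : q0 a = 0) a1.
have cu1 : qnorm2 (qconj u) = 1 by rewrite qnorm2_conj.
exists (qconj u), b; split; rewrite ?(ltW b0)//.
have -> : p = qreal (q0 p) + b *: a.
  by apply: quatP; rewrite /a /qreal !qcoordE; field; rewrite ?gt_eqF.
rewrite rotD rot_real// rotZ -ua -{2}[u]qconjK rot_conjK// /qi.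
by apply: quatP; rewrite /qreal !qcoordE; ring.
Qed.

Lemma exists_mob_imag (x b : R) : 0 <= b -> qball (mkQ x b 0 0) ->
  exists t (c : R), 0 <= c /\ mob (tanh t) (mkQ x b 0 0) = c *: qi R.
Proof.
set q := mkQ x b 0 0 => b0 hq.
have nq : qnorm2 q = x ^+ 2 + b ^+ 2 by rewrite /qnorm2 /q !qcoordE; ring.
have N1 : x ^+ 2 + b ^+ 2 < 1 by rewrite -nq.
set S := 1 + (x ^+ 2 + b ^+ 2); set D := Num.sqrt (S ^+ 2 - 4 * x ^+ 2).
have Sp : 0 < S by rewrite /S; nra.
have Dp : 0 < S ^+ 2 - 4 * x ^+ 2.
  rewrite (_ : _ - _ = (1 - x ^+ 2) ^+ 2 + b ^+ 2 * (b ^+ 2 + 2 * (1 + x ^+ 2)));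
    last by rewrite /S; ring.
  rewrite ltr_wpDr//; first by rewrite mulr_ge0 ?addr_ge0 ?mulr_ge0 ?addr_ge0 ?sqr_ge0.
  by rewrite exprn_gt0//; nra.
have D0 : 0 < D by rewrite sqrtr_gt0.
have DD : D ^+ 2 = S ^+ 2 - 4 * x ^+ 2 by rewrite sqr_sqrtr// ltW.
have SD : 0 < S + D by rewrite addr_gt0.
(* The real part of the image vanishes when x a^2 + S a + x = 0. This is the root in (-1, 1), in the
   form that remains meaningful for x = 0. *)
pose a := - (2 * x) / (S + D).
have a1 : a ^+ 2 < 1.
  rewrite /a expr_div_n ltr_pdivrMr ?exprn_gt0// mul1r sqrrN.
  by nra.
have [t ta] := tanh_surj a1; have M0 := mobN_gt0 a1 hq.
exists t, ((1 - a ^+ 2) * b / mobN a q); split.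
  by rewrite divr_ge0 ?mulr_ge0 ?(ltW M0)// subr_ge0 ltW.
rewrite ta mobE; apply: quatP;
  rewrite /qi /qreal /qconj !qcoordE ?nq -/S /q ?qcoordE; try ring.
rewrite mulr0; apply/eqP; rewrite mulf_eq0; apply/orP; right; apply/eqP.
rewrite (_ : x + a * S + a ^+ 2 * x = x * (D ^+ 2 - S ^+ 2 + 4 * x ^+ 2) / (S + D) ^+ 2).
  by rewrite DD; field; rewrite gt_eqF.
by rewrite /a; field; rewrite gt_eqF.
Qed.

Lemma act_to_imag p : qball p ->
  exists (x : grp R) d, [/\ in_grp x, 0 <= d & act x p = tanh d *: qi R].
Proof.
move=> hp; have [u [b [u1 b0 ub]]] := exists_rot_slice p.
have hb : qball (mkQ (q0 p) b 0 0) by rewrite -ub /qball /= rot_norm.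
have [t [c [c0 mc]]] := exists_mob_imag b0 hb.
have hc : qball (c *: qi R) by rewrite -mc; exact: mob_ball (tanh_sqr_lt1 t) hb.
have c1 : c ^+ 2 < 1 by move: hc; rewrite /qball /= qnorm2Z qnorm2_qi mulr1.
have [d dc] := tanh_surj c1.
have gx : in_grp (u, 1, t, 1 : R) by do 2! (split => //; try by left).
exists (u, 1, t, 1), d; split=> //; first by apply: tanh_ge0_inv; rewrite dc.
by rewrite actE /cj eqxx scale1r -rot_mob// ub mc dc.
Qed.

End Transitivity.

(** * Isometries that shift the origin along the imaginary axis *)

Section FixedOrigin.
Variable R : realType.
Implicit Types (p q u v w : quat R) (f h : quat R -> quat R) (d s t : R).

Local Arguments act : simpl never.

Local Notation qi := (qi R).
Local Notation qj := (qj R).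

Definition line_refl : grp R := (qi, -1, 0, -1).

Lemma line_refl_in : in_grp line_refl.
Proof. by split; [exact: qnorm2_qi | split; right]. Qed.

Lemma act_line_refl q : act line_refl q = mkQ (- q0 q) (q1 q) (- q2 q) (- q3 q).
Proof.
rewrite /line_refl actE tanh0 mob0 /cj sign_neq /rot.
by apply: quatP; rewrite /qi /qmul /qconj !qcoordE; ring.
Qed.

Definition antipode : grp R := (qreal 1, -1, 0, 1).

Lemma antipode_in : in_grp antipode.
Proof. by split; [rewrite /Sp1 /= qnorm2_real expr1n | split; [right|left]]. Qed.

Lemma act_antipode q : act antipode q = - q.
Proof.
rewrite /antipode actE tanh0 mob0 /cj eqxx /rot.
by apply: quatP; rewrite /qmul /qconj /qreal !qcoordE; ring.
Qed.

(** The derivative is 1 or -1 at each point but is not assumed continuous; injectivity makes psi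
    monotone, which fixes the sign. *)
Lemma unit_speed_line (psi dpsi : R -> R) :
  (forall s, is_derive s 1 psi (dpsi s)) -> (forall s, dpsi s ^+ 2 = 1) ->
  injective psi ->
  (forall s, psi s = psi 0 + s) \/ (forall s, psi s = psi 0 - s).
Proof.
move=> D D2 inj.
have der s : derivable psi s 1 by have [] := D s.
have dE s : psi^`() s = dpsi s by rewrite derive1E; have [] := D s.
have cst (g : R -> R) (e : R) : (forall s, is_derive s 1 g e) -> forall s, g s = g 0 + e * s.
  move=> Dg s; suff : g s - e * s = g 0 - e * 0.
    by rewrite mulr0 subr0 => <-; rewrite subrK.
  apply: (@is_derive_0_is_cst _ (fun t => g t - e * t)) => t.
  have := is_derive1_add (Dg t) (is_derive1_opp (is_derive1_mul (is_derive_cst e t 1) (is_derive_id t 1))).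
  by move/is_derive_eq; apply; rewrite /=; ring.
have cont : {within [set` `]-oo, +oo[%R], continuous psi}.
  apply: continuous_subspaceT => s.
  exact/differentiable_continuous/derivable1_diffP/der.
have mono := itv_continuous_inj_mono cont (in2W inj).
have dpm s : dpsi s = 1 \/ dpsi s = -1.
  by have /eqP := D2 s; rewrite sqrf_eq1 => /orP[] /eqP; [left|right].
case: mono => mono; [left|right].
  move=> s; rewrite -[s in RHS]mul1r; apply: (cst psi 1) => t.
  have [E|E] := dpm t; first by have := D t; rewrite E.
  have : 0 <= psi^`() t.
    apply: (@incr_derive1_ge0 _ psi setT); rewrite ?interiorT//.
    by move=> x y _ _; apply: mono; rewrite in_itv.
  by rewrite dE E; lra.
move=> s; rewrite -mulN1r; apply: (cst psi (-1)) => t.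
have [E|E] := dpm t; last by have := D t; rewrite E.
have : psi^`() t <= 0.
  apply: (@decr_derive1_le0 _ psi setT); rewrite ?interiorT//.
  by move=> x y _ _ xy; apply: mono; rewrite ?in_itv.
by rewrite dE E; lra.
Qed.

(* h o (reflection in R i) o f fixes 0 and h 0, hence, being linear, the whole
   diameter through h 0: f maps it to the fixed line R i, at unit speed. *)
Lemma risom_line f h d : risom f h -> 0 < d -> f 0 = tanh d *: qi ->
  exists2 V, qnorm2 V = 1 & forall s, f (tanh s *: V) = tanh (d + s) *: qi.
Proof.
move=> rf d0 f0; have B0 := @qball0 R.
have td : 0 < tanh d.
  rewrite lt_neqAle tanh_ge0 ?ltW// andbT; apply/eqP.
  by rewrite -tanh0 => /tanh_inj E; move: d0; rewrite E ltxx.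
have rR := act_risom line_refl_in.
pose F := h \o act line_refl \o f.
have rF : risom F _ := risom_comp (risom_comp (risom_sym rf) rR) rf.
have F0 : F 0 = 0.
  rewrite /F /= f0 (_ : act _ _ = tanh d *: qi) -?f0 ?(risomK rf)//.
  by rewrite f0 act_line_refl; apply: quatP; rewrite /qi !qcoordE; ring.
have [L oL FL] := risom0_orth rF F0.
have Bh := risom_ballV rf B0; have [s0 [w [_ w1 hw]]] := polar Bh.
have Fh : F (h 0) = h 0.
  rewrite /F /= (risomVK rf)// (_ : act _ 0 = 0)//.
  by rewrite act_line_refl; apply: quatP; rewrite !qcoordE; ring.
have ts0 : tanh s0 != 0.
  apply: contraTneq td => E; have : h 0 = 0 by rewrite hw E scale0r.
  move=> /(congr1 f); rewrite (risomVK rf)// f0 => /(congr1 (@q1 R)).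
  by rewrite /qi !qcoordE mulr1 => <-; rewrite ltxx.
have Lw : L w = w.
  have := FL _ Bh; rewrite Fh hw (orthZ oL) => /(congr1 (fun v => (tanh s0)^-1 *: v)).
  by rewrite !scalerA mulVf// !scale1r.
have Fw s : F (tanh s *: w) = tanh s *: w.
  by rewrite FL ?(orthZ oL) ?Lw//; exact: unit_tanh_ball.
have bw s := unit_tanh_ball s w1.
pose phi s := q1 (f (tanh s *: w)).
have fphi s : f (tanh s *: w) = phi s *: qi.
  have hs := risom_ball rf (bw s).
  (* A fixed point of F is a point whose image under f is fixed by the reflection, hence lies on R
     i. *)
  have : act line_refl (f (tanh s *: w)) = f (tanh s *: w).
    by rewrite -[in RHS](Fw s) /F /= (risomVK rf)//; exact: act_ball line_refl_in hs.
  rewrite act_line_refl => E.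
  have e0 := congr1 (@q0 R) E; have e2 := congr1 (@q2 R) E; have e3 := congr1 (@q3 R) E.
  rewrite !qcoordE in e0 e2 e3.
  by apply: quatP; rewrite /phi /qi !qcoordE; lra.
have phi1 s : phi s ^+ 2 < 1.
  by have := risom_ball rf (bw s); rewrite fphi /qball /= qnorm2Z qnorm2_qi mulr1.
have dphi s : exists2 e, is_derive s 1 phi e & e ^+ 2 = (1 - phi s ^+ 2) ^+ 2.
  have [v dv gv] := is_derive_ray s rf w1.
  have d1 := is_derive1_coord (inord 1) dv.
  exists (q1 v); first exact: d1.
  have : v = q1 v *: qi.
    have d2 := is_derive1_scale qi d1.
    have E : (fun t => f (tanh t *: w)) = (fun t => phi t *: qi) by apply/funext.
    by rewrite E in dv; have [_ ev] := dv; have [_ ed] := d2; rewrite -[LHS]ev; exact: ed.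
  move=> vE; move: gv; rewrite fphi vE slice_q_colinear; last first.
    by have := risom_ball rf (bw s); rewrite fphi.
  have m0 : 1 - phi s ^+ 2 != 0 by rewrite gt_eqF// subr_gt0.
  rewrite qnorm2_qi !mulr1 => /(congr1 (fun x => x * (1 - phi s ^+ 2) ^+ 2)).
  by rewrite mulfVK ?expf_neq0// mul1r -vE.
pose psi s := atanh (phi s).
have fpsi s : f (tanh s *: w) = tanh (psi s) *: qi by rewrite fphi atanhK.
have D s : exists e, is_derive s 1 psi e /\ e ^+ 2 = 1.
  have [e de e2] := dphi s; exists ((1 - phi s ^+ 2)^-1 * e); split.
    exact: (@is_derive1_comp _ (@atanh R) phi s _ _ (is_derive_atanh (phi1 s)) de).
  by rewrite exprMn e2 exprVn mulVf// expf_neq0// gt_eqF// subr_gt0.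
have inj : injective psi.
  move=> s t psiE.
  have : f (tanh s *: w) = f (tanh t *: w) by rewrite (fpsi s) (fpsi t) psiE.
  move=> /(risom_inj rf (bw s) (bw t)) E; apply: tanh_inj.
  have w0 : w != 0 by apply/eqP => w0; move: w1; rewrite w0 qnorm2_0; lra.
  apply/eqP; rewrite -subr_eq0; have : (tanh s - tanh t) *: w == 0.
    by rewrite scalerBl E subrr.
  by rewrite scaler_eq0 (negbTE w0) orbF.
have psi0 : psi 0 = d.
  have := fpsi 0; rewrite tanh0 scale0r f0 => /(congr1 (@q1 R)).
  by rewrite /qi !qcoordE !mulr1 => /tanh_inj ->.
have [dpsi Dp] := choice D.
have [E|E] := @unit_speed_line psi dpsi (fun s => (Dp s).1) (fun s => (Dp s).2) inj.
  by exists w => // s; rewrite fpsi E psi0.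
(* If psi decreases, the diameter is traversed in the opposite direction. *)
exists (- w) => [|s]; first by rewrite qnorm2N.
by rewrite scalerN -scaleNr -tanhN fpsi E psi0 opprK.
Qed.

(** The tangent anticommutes with the point, so the factors 1 - N cancel and the squared speed is N
    / (1 + N)^2, at most 1/4 for every radius. *)
Lemma slice_q_circle (x y : R) : x ^+ 2 + y ^+ 2 < 1 ->
  slice_q (mkQ 0 x y 0) (mkQ 0 (- y) x 0) <= 2^-1 ^+ 2.
Proof.
set N := x ^+ 2 + y ^+ 2 => N1; have N0 : 0 <= N by rewrite addr_ge0 ?sqr_ge0.
have nq : qnorm2 (mkQ 0 x y 0) = N by rewrite /N /qnorm2 !qcoordE; ring.
rewrite slice_qE (_ : qden _ = (1 + N) ^+ 2); last first.
  by rewrite qdenE nq !qcoordE /N; ring.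
rewrite (_ : qnorm2 (mkQ 0 (- y) x 0) = N); last by rewrite /N /qnorm2 !qcoordE; ring.
rewrite (_ : cross2 _ _ = N ^+ 2); last by rewrite /cross2 !qcoordE /N; ring.
rewrite nq (_ : _ / _ = N / (1 + N) ^+ 2); last first.
  by field; rewrite !gt_eqF ?subr_gt0// ltr_pwDl.
rewrite ler_pdivrMr ?exprn_gt0 ?ltr_pwDl//.
by rewrite -subr_ge0 (_ : _ - _ = (2^-1 * (1 - N)) ^+ 2) ?sqr_ge0//; field.
Qed.

(* Compare the distances from f 0 of the two ends of a half circle of radius
   tanh (2 d): they differ by 2 d, while the half circle is shorter than 2. *)
Lemma risom_shift_lt1 f h d : risom f h -> 0 < d -> f 0 = tanh d *: qi -> d < 1.
Proof.
move=> rf d0 f0; have [V V1 fV] := risom_line rf d0 f0.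
have hV s : h (tanh s *: qi) = tanh (s - d) *: V.
  by rewrite -(risomK rf (unit_tanh_ball (s - d) V1)) fV addrCA subrr addr0.
(* Any radius larger than tanh d would do: the circle then avoids f 0, so its image under h avoids
   0, and the distances of its ends differ by exactly 2 d. *)
set r := tanh (2 * d); have r1 : r ^+ 2 < 1 := tanh_sqr_lt1 _.
pose e t := mkQ 0 (r * cos t) (r * sin t) 0.
have eE t : e t = (r * cos t) *: qi + (r * sin t) *: qj.
  by rewrite /e /qi /qj; apply: quatP; rewrite !qcoordE; ring.
have circ t : (r * cos t) ^+ 2 + (r * sin t) ^+ 2 = r ^+ 2.
  by rewrite !exprMn -mulrDr cos2Dsin2 mulr1.
have en t : qnorm2 (e t) = r ^+ 2.
  by rewrite -(circ t) /e /qnorm2 !qcoordE; ring.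
have eb t : qball (e t) by rewrite /qball /= en.
have de t : is_derive t 1 e (mkQ 0 (- (r * sin t)) (r * cos t) 0).
  have dc := is_derive1_scale qi (is_derive1_mul (is_derive_cst r t 1) (is_derive_cos t)).
  have ds := is_derive1_scale qj (is_derive1_mul (is_derive_cst r t 1) (is_derive_sin t)).
  rewrite (_ : e = (fun t => (r * cos t) *: qi) + (fun t => (r * sin t) *: qj));
    last exact/funext.
  apply: (is_derive_eq (is_deriveD dc ds)).
  by apply: quatP; rewrite /qi /qj /= !qcoordE; ring.
have hd t := is_derive1_curve (risom_diffV rf (eb t)) (de t).
have := @hdist_growth R (fun t => h (e t)) 0 pi 2^-1 (pi_ge0 _) _.
rewrite invr_ge0 => /(_ (ler0n _ _)) H.
have {H} : hdist (h (e pi)) - hdist (h (e 0)) <= 2^-1 * (pi - 0).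
  apply: H => [t _|t _].
    split; first exact: risom_ballV rf _ (eb t).
    exact: is_derive1_continuous (hd t).
  split; last first.
    exists ('D_(mkQ 0 (- (r * sin t)) (r * cos t) 0) h (e t)); split; first exact: hd.
    rewrite (risom_metric (risom_sym rf))//; apply: slice_q_circle.
    by rewrite circ.
  apply/eqP => /(congr1 f); rewrite (risomVK rf)// => E.
  have : qnorm2 (e t) = tanh d ^+ 2 by rewrite E f0 qnorm2Z qnorm2_qi mulr1.
  rewrite en => /eqP; rewrite eqf_sqr => /orP[] /eqP.
    by move=> /tanh_inj ?; lra.
  by rewrite -tanhN => /tanh_inj ?; lra.
have -> : e 0 = tanh (2 * d) *: qi.
  by rewrite eE cos0 sin0 mulr1 mulr0 scale0r addr0.
have -> : e pi = tanh (- (2 * d)) *: qi.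
  by rewrite eE cospi sinpi mulrN1 mulr0 scale0r addr0 tanhN.
(* The ends lie at distances 3 d and d, and the arc of speed at most 1/2 and duration pi bounds the
   difference by pi / 2 < 2. *)
rewrite !hV !hdist_tanh// ltr0_norm; last by lra.
rewrite gtr0_norm; last by lra.
have /andP[_ p2] := pihalf_02 R.
by lra.
Qed.

(* f o (-1) o h moves the origin twice as far as f. *)
Lemma risom_double f h d : risom f h -> 0 < d -> f 0 = tanh d *: qi ->
  exists f' h', risom f' h' /\ f' 0 = tanh (2 * d) *: qi.
Proof.
move=> rf d0 f0; have [V V1 fV] := risom_line rf d0 f0.
exists (f \o act antipode \o h), (f \o (act (grp_inv antipode) \o h)); split.
  exact: risom_comp (risom_comp rf (act_risom antipode_in)) (risom_sym rf).
have -> : (f \o act antipode \o h) 0 = f (- h 0) by rewrite /= act_antipode.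
have -> : h 0 = tanh (- d) *: V.
  rewrite -(risomK rf (unit_tanh_ball (- d) V1)) fV subrr tanh0 scale0r//.
by rewrite tanhN scaleNr opprK fV mulrDl mul1r.
Qed.

(** Doubling n times gives 2^n d < 1 for every n; since n < 2^n, this contradicts the Archimedean
    property. *)
Lemma risom_no_shift f h d : risom f h -> 0 < d -> f 0 != tanh d *: qi.
Proof.
move=> rf d0; apply/eqP => f0.
have iter (n : nat) : exists f' h', risom f' h' /\ f' 0 = tanh (2 ^+ n * d) *: qi.
  elim: n => [|n [f' [h' [rf' f0']]]]; first by exists f, h; rewrite expr0 mul1r.
  have [|f'' [h'' [rf'' f0'']]] := risom_double rf' _ f0'.
    by rewrite mulr_gt0// exprn_gt0.
  by exists f'', h''; rewrite exprS -mulrA.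
have bnd (n : nat) : n%:R < d^-1.
  have [f' [h' [rf' f0']]] := iter n.
  have /(risom_shift_lt1 rf')/(_ f0') : 0 < 2 ^+ n * d by rewrite mulr_gt0// exprn_gt0.
  rewrite -ltr_pdivlMr// div1r; apply: le_lt_trans.
  by rewrite -natrX ler_nat ltnW// ltn_expl.
have := bnd (Num.bound d^-1); rewrite ltNge => /negP; apply.
by apply/ltW; apply: archi_boundP; rewrite invr_ge0 ltW.
Qed.

Lemma slice_isometry_act f : slice_isometry f -> is_act f.
Proof.
move=> /slice_isometry_risom[h rf]; have hf0 := risom_ball rf (@qball0 R).
have [x [d [hx d0 xE]]] := act_to_imag hf0.
apply: (is_act_postcomp hx); first exact: (risom_ball rf).
have rx := risom_comp (act_risom hx) rf.
apply: (risom0_act rx); rewrite /= xE.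
move: d0; rewrite le_eqVlt => /predU1P[<-|d0]; first by rewrite tanh0 scale0r.
by have := risom_no_shift rx d0; rewrite /= xE eqxx.
Qed.

End FixedOrigin.

Theorem theorem3p4 (R : realType) :
  [/\ (forall (x : grp R) (q : quat R), in_grp x -> qball q -> qball (act x q)),
      (forall q : quat R, qball q -> act (grp_one R) q = q),
      (forall (x y : grp R) (q : quat R), in_grp x -> in_grp y -> qball q ->
          act (grp_mul x y) q = act x (act y q)) &
      (forall f : quat R -> quat R,
          slice_isometry f <->
          exists x : grp R, in_grp x /\ (forall q, qball q -> f q = act x q))].
Proof.
split.
- exact: act_ball.
- by move=> q _; exact: act1.
- exact: act_mul.
move=> f; split; first exact: slice_isometry_act.
move=> [x [hx fx]]; apply: slice_isometry_eq (act_slice_isometry hx) => q hq.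
by rewrite fx.
Qed.
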